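(* Let $(R,\mathfrak m)$ be a one-dimensional Cohen-Macaulay local ring having a canonical module $\omega_R$. If $R$ is generically Gorenstein, then $h(\omega_R)\le 2\,bg(R)$.
   Context: All rings are commutative Noetherian. $R$ is generically Gorenstein if $R_{\mathfrak p}$ is Gorenstein for all $\mathfrak p\in\operatorname{Ass}(R)$. For a finitely generated $R$-module $M$, $h(M)=\inf\{\ell_R(R/\operatorname{Im} f)\mid f\in\operatorname{Hom}_R(M,R)\}$. $\mathrm{Q}(-)$ denotes the total quotient ring. The birational Gorenstein colength of $R$ is $bg(R)=\inf\{\ell_S(R/S)\mid S\subseteq R \text{ is a subring with } R \text{ module-finite over } S,\ \mathrm{Q}(S)=\mathrm{Q}(R),\text{ and } S \text{ is Gorenstein}\}$ (with $\inf\emptyset=\infty$). Here $\ell$ denotes length. *)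

(* Defs.v *)
From HB Require Import structures.
From mathcomp Require Import all_boot all_order all_algebra.
From mathcomp Require Import generic_quotient ring_quotient.
From mathcomp Require Import boolp classical_sets functions.

Set Implicit Arguments.
Unset Strict Implicit.
Unset Printing Implicit Defensive.

Import GRing.Theory.
Local Open Scope ring_scope.
Local Open Scope quotient_scope.

(* [None] stands for infinity. *)
Definition enat := option nat.

Definition enat_le (x y : enat) : bool :=
  match x, y with
  | _, None => true
  | None, Some _ => false
  | Some m, Some n => (m <= n)%N
  end.

Definition enat_double (x : enat) : enat := omap (muln 2) x.

(* The least element of [P], or infinity when [P] is empty. *)
Definition enat_least (P : set nat) : enat :=
  if pselect (exists n, `[< P n >]) is left exP then Some (ex_minn exP)
  else None.

Definition enat_inf (A : set enat) : enat :=
  enat_least [set n | A (Some n)].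

(* The least upper bound; it is 0 for the empty set. *)
Definition enat_sup (P : set nat) : enat :=
  enat_least [set b | forall n, P n -> (n <= b)%N].

(* [Quotient.quot] asks for [zmodClosed]; over a ring, submodules are closed under
   opposites, but [submodClosed] does not record it. *)
Section QuotientModule.
Variables (R : pzRingType) (M : lmodType R) (N : submodClosed M).

Definition zmod_of_submod : {pred M} := fun x => x \in N.

Fact zmod_of_submod_closed : zmod_closed zmod_of_submod.
Proof.
split=> [|x y Nx Ny]; rewrite -?[_ \in zmod_of_submod]/(_ \in N).
  exact: rpred0.
by rewrite rpredD // -scaleN1r rpredZ.
Qed.
HB.instance Definition _ :=
  GRing.isZmodClosed.Build M zmod_of_submod zmod_of_submod_closed.

Definition quotmod := Quotient.quot zmod_of_submod.

HB.instance Definition _ := GRing.Zmodule.on quotmod.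
HB.instance Definition _ := EqQuotient.on quotmod.

Definition quot_scale (a : R) (x : quotmod) : quotmod := \pi_quotmod (a *: repr x).

Fact pi_quot_scale a (x : M) : quot_scale a (\pi_quotmod x) = \pi_quotmod (a *: x).
Proof.
apply/eqP; rewrite /quot_scale -Quotient.idealrBE -scalerBr.
rewrite -[_ \in zmod_of_submod]/(_ \in N) rpredZ //.
by rewrite -[_ \in N]/(_ \in zmod_of_submod) Quotient.idealrBE reprK.
Qed.

Fact pi_quotD (x y : M) : \pi_quotmod x + \pi_quotmod y = \pi_quotmod (x + y).
Proof. exact/esym/Quotient.pi_add. Qed.

Fact quot_scaleA a b x : quot_scale a (quot_scale b x) = quot_scale (a * b) x.
Proof.
by elim/quotW: x => x; rewrite (pi_quot_scale b) 2!pi_quot_scale scalerA.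
Qed.

Fact quot_scale1 : left_id 1 quot_scale.
Proof. by move=> x; elim/quotW: x => x; rewrite pi_quot_scale scale1r. Qed.

Fact quot_scaleDr : right_distributive quot_scale +%R.
Proof.
move=> a x y; elim/quotW: x => x; elim/quotW: y => y.
by rewrite pi_quotD !pi_quot_scale scalerDr pi_quotD.
Qed.

Fact quot_scaleDl x : {morph quot_scale^~ x : a b / a + b}.
Proof.
by move=> a b; elim/quotW: x => x; rewrite !pi_quot_scale scalerDl pi_quotD.
Qed.

HB.instance Definition _ := GRing.Zmodule_isLmodule.Build R quotmod
  quot_scaleA quot_scale1 quot_scaleDr quot_scaleDl.

End QuotientModule.

Section SubmoduleType.
Variables (R : pzRingType) (M : lmodType R) (N : submodClosed M).

Record submodtype := SubmodType { submod_val : M; _ : submod_val \in N }.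

HB.instance Definition _ := [isSub for submod_val].
HB.instance Definition _ := [Choice of submodtype by <:].
HB.instance Definition _ := [SubChoice_isSubLmodule of submodtype by <:].
End SubmoduleType.

Section Modules.
Variables (R : pzRingType).
Implicit Types M N : lmodType R.

Definition lrange_pred M N (f : {linear M -> N}) : {pred N} :=
  fun y => `[< exists x, f x = y >].

Fact lrange_closed M N (f : {linear M -> N}) : submod_closed (lrange_pred f).
Proof.
split=> [|a _ _ /asboolP[x <-] /asboolP[y <-]]; apply/asboolP.
  by exists 0; rewrite linear0.
by exists (a *: x + y); rewrite linearP.
Qed.
HB.instance Definition _ M N (f : {linear M -> N}) :=
  GRing.isSubmodClosed.Build R N (lrange_pred f) (lrange_closed f).

Definition lrange M N (f : {linear M -> N}) : submodClosed N := lrange_pred f.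

Definition finitely_generated M :=
  exists (n : nat) (e : 'I_n -> M),
    forall x, exists c : 'I_n -> R, x = \sum_i c i *: e i.

Definition sub_proper M (N1 N2 : submodClosed M) :=
  {subset N1 <= N2} /\ exists2 x, x \in N2 & x \notin N1.

(* The supremum of the lengths [n] of chains of submodules
   N_0 < N_1 < ... < N_n. *)
Definition module_length M : enat :=
  enat_sup [set n | exists N : nat -> submodClosed M,
                      forall i, (i < n)%N -> sub_proper (N i) (N i.+1)].

Definition injective_module (E : lmodType R) :=
  forall (A B : lmodType R) (i : {linear A -> B}) (f : {linear A -> E}),
    injective i -> exists g : {linear B -> E}, forall a, g (i a) = f a.

(* 0 -> M -> I_0 -> I_1 -> ... *)
Record injective_resolution M := InjectiveResolution {
  ir_obj : nat -> lmodType R;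
  ir_aug : {linear M -> ir_obj 0%N};
  ir_d : forall n, {linear ir_obj n -> ir_obj n.+1};
  ir_injective : forall n, injective_module (ir_obj n);
  ir_aug_inj : injective ir_aug;
  ir_exact0 : forall x, ir_d 0%N x = 0 <-> exists y, ir_aug y = x;
  ir_exactS : forall n x, ir_d n.+1 x = 0 <-> exists y, ir_d n y = x
}.

Definition finite_injdim M :=
  exists (I : injective_resolution M) (n : nat),
    forall i, (n < i)%N -> forall x : ir_obj I i, x = 0.

End Modules.

(* Ext^n(N, M) is the n-th cohomology of the complex Hom(N, I) for an
   injective resolution I of M; Hom(N, I_n) sits in the module of all
   functions N -> I_n. *)
Section Ext.
Variables (R : comPzRingType) (N M : lmodType R) (I : injective_resolution M).

Definition cocycle_pred n : {pred N -> ir_obj I n} :=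
  fun f => `[< linear f /\ forall x, ir_d I n (f x) = 0 >].

Fact cocycle_closed n : submod_closed (@cocycle_pred n).
Proof.
split=> [|a f g /asboolP[lf df] /asboolP[lg dg]]; apply/asboolP.
  split=> [b x y|x]; last exact: linear0.
  by rewrite -[RHS]/(b *: 0 + 0) scaler0 addr0.
split=> [b x y|x] /=; last by rewrite linearP df dg scaler0 addr0.
rewrite !fctE lf lg !scalerDr !scalerA (mulrC a b).
by rewrite -!addrA; congr (_ + _); rewrite addrCA.
Qed.
HB.instance Definition _ n :=
  GRing.isSubmodClosed.Build R _ (@cocycle_pred n) (@cocycle_closed n).

Definition cocycles n := submodtype (@cocycle_pred n : submodClosed _).

Definition coboundary_pred n : {pred cocycles n} := fun f =>
  match n return cocycles n -> bool with
  | 0 => fun f => f == 0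
  | n'.+1 => fun f => `[< exists g : {linear N -> ir_obj I n'},
                            val f = ir_d I n' \o g >]
  end f.

Fact coboundary_closed n : submod_closed (@coboundary_pred n).
Proof.
case: n => [|n]; split.
- exact: eqxx.
- by move=> a f g /eqP-> /eqP->; rewrite scaler0 addr0; exact: eqxx.
- by apply/asboolP; exists \0; apply/funext=> x /=; rewrite linear0.
move=> a f g /asboolP[f' Ef] /asboolP[g' Eg]; apply/asboolP.
have lin : linear (fun x => a *: f' x + g' x).
  move=> b x y; rewrite (linearP f') (linearP g') !scalerDr !scalerA (mulrC a b).
  by rewrite -!addrA; congr (_ + _); rewrite addrCA.
pose h := HB.pack_for {linear N -> ir_obj I n} (fun x => a *: f' x + g' x)
  (GRing.isLinear.Build _ _ _ _ _ lin).
exists h; apply/funext => x.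
by rewrite -[LHS]/(a *: val f x + val g x) Ef Eg [RHS]linearP.
Qed.
HB.instance Definition _ n :=
  GRing.isSubmodClosed.Build R _ (@coboundary_pred n) (@coboundary_closed n).

Definition ext n := quotmod (@coboundary_pred n : submodClosed _).

End Ext.

Section Rings.
Variables (R : comNzRingType).
Implicit Types (M : lmodType R) (I : idealr R) (p : prime_idealr R).

Definition noetherian :=
  forall I, exists (n : nat) (e : 'I_n -> R),
    forall x, x \in I <-> exists c : 'I_n -> R, x = \sum_i c i * e i.

Definition maximal_ideal (m : idealr R) :=
  forall I, {subset m <= I} -> {subset I <= m}.

Definition local_ring (m : idealr R) :=
  maximal_ideal m /\ forall m' : idealr R, maximal_ideal m' -> m' =i m.

Definition krull_dim : enat :=
  enat_sup [set n | exists p : nat -> prime_idealr R,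
    forall i, (i < n)%N ->
      {subset p i <= p i.+1} /\ exists2 x, x \in p i.+1 & x \notin p i].

Definition idealr_submod (I : idealr R) : {pred R^o} := fun x => x \in I.

Fact idealr_submod_closed I : submod_closed (idealr_submod I).
Proof.
split=> [|a x y Ix Iy]; first exact: idealr0.
exact: rpredD (idealMr _ Ix) Iy.
Qed.
HB.instance Definition _ I :=
  GRing.isSubmodClosed.Build R R^o (idealr_submod I) (idealr_submod_closed I).

(* R/m as an R-module. *)
Definition residue (m : idealr R) :=
  quotmod (idealr_submod m : submodClosed R^o).

(* The submodule (x_1, ..., x_n) M. *)
Definition seq_mul_pred M (xs : seq R) : {pred M} := fun v =>
  `[< exists u : nat -> M, v = \sum_(i < size xs) xs`_i *: u i >].

Fact seq_mul_closed M xs : submod_closed (@seq_mul_pred M xs).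
Proof.
split=> [|a _ _ /asboolP[u ->] /asboolP[v ->]]; apply/asboolP.
  by exists (fun=> 0); rewrite big1 // => i _; rewrite scaler0.
exists (fun i => a *: u i + v i).
rewrite scaler_sumr -big_split; apply: eq_bigr => i _ /=.
by rewrite scalerDr !scalerA mulrC.
Qed.
HB.instance Definition _ M xs :=
  GRing.isSubmodClosed.Build R M (@seq_mul_pred M xs) (@seq_mul_closed M xs).

Definition seq_quot M (xs : seq R) :=
  quotmod (@seq_mul_pred M xs : submodClosed M).

Definition regular_sequence M (xs : seq R) :=
  (forall i, (i < size xs)%N ->
     forall v : seq_quot M (take i xs), xs`_i *: v = 0 -> v = 0) /\
  (exists v : seq_quot M xs, v != 0).

Definition depth (m : idealr R) M : enat :=
  enat_sup [set n | exists xs : seq R,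
    [/\ size xs = n, {subset xs <= m} & regular_sequence M xs]].

Definition cohen_macaulay_local (m : idealr R) := depth m R^o = krull_dim.

(* An R-module killed by m is a k-vector space, k = R/m, and an R-linear map
   between such modules is k-linear: [X] is isomorphic to k^r. *)
Definition residue_dim (m : idealr R) (X : lmodType R) (r : nat) :=
  exists f : {linear ('I_r -> residue m) -> X}, bijective f.

(* dim_k Ext^t(k, M) = r for t = depth M *)
Definition has_type (m : idealr R) M (r : nat) :=
  exists (t : nat) (I : injective_resolution M),
    depth m M = Some t /\ residue_dim m (ext (residue m) I t) r.

(* A maximal Cohen-Macaulay module of type 1 and of finite injective
   dimension (Bruns-Herzog, Definition 3.3.1). *)
Definition canonical_module (m : idealr R) (C : lmodType R) :=
  [/\ finitely_generated C, depth m C = krull_dim,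
      has_type m C 1%N & finite_injdim C].

Definition h_invariant M : enat :=
  enat_inf [set l | exists f : {linear M -> R^o},
                      l = module_length (quotmod (lrange f))].

Definition associated_prime p :=
  exists x : R, forall a, a \in p <-> a * x = 0.

Definition nonzerodivisors : set R := [set a | forall b, a * b = 0 -> b = 0].

End Rings.

(* [phi] exhibits [L] as the localization of [R] at [W]. *)
Definition is_localization (R L : comNzRingType) (W : set R)
    (phi : {rmorphism R -> L}) :=
  [/\ forall w, W w -> exists u, phi w * u = 1,
      forall y, exists a w, W w /\ y * phi w = phi a
    & forall a, phi a = 0 -> exists2 w, W w & w * a = 0].

Definition gorenstein_local (R : comNzRingType) :=
  [/\ noetherian R, exists m : idealr R, local_ring m
    & finite_injdim (R^o : lmodType R)].

(* The localization of R at the prime ideal with underlying set [P] is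
   Gorenstein; localizations are unique up to isomorphism. *)
Definition gorenstein_at (R : comNzRingType) (P : {pred R}) :=
  forall (L : comNzRingType) (phi : {rmorphism R -> L}),
    is_localization [set w | w \notin P] phi -> gorenstein_local L.

Definition gorenstein (R : comNzRingType) :=
  noetherian R /\ forall m : idealr R, maximal_ideal m -> gorenstein_at m.

Definition generically_gorenstein (R : comNzRingType) :=
  forall p : prime_idealr R, associated_prime p -> gorenstein_at p.

(* R as a module over the subring S. *)
Definition over_subring (R : comNzRingType) (S : subringClosed R) : Type := R.

Section Subrings.
Variables (R : comNzRingType) (S : subringClosed R).

Record subringtype := SubringType { subring_val : R; _ : subring_val \in S }.

HB.instance Definition _ := [isSub for subring_val].
HB.instance Definition _ := [Choice of subringtype by <:].
HB.instance Definition _ := [SubChoice_isSubComNzRing of subringtype by <:].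

Definition subring_incl : {rmorphism subringtype -> R} := val.

Local Notation over_subring := (over_subring S).
HB.instance Definition _ := GRing.Zmodule.on over_subring.

Definition subring_scale (a : subringtype) (x : over_subring) : over_subring :=
  (val a * x : R).

Fact subring_scaleA a b x :
  subring_scale a (subring_scale b x) = subring_scale (a * b) x.
Proof. exact: mulrA. Qed.
Fact subring_scale1 : left_id 1 subring_scale.
Proof. exact: mul1r. Qed.
Fact subring_scaleDr : right_distributive subring_scale +%R.
Proof. by move=> a x y; exact: mulrDr. Qed.
Fact subring_scaleDl x : {morph subring_scale^~ x : a b / a + b}.
Proof. by move=> a b; exact: mulrDl. Qed.
HB.instance Definition _ := GRing.Zmodule_isLmodule.Build subringtype
  over_subring subring_scaleA subring_scale1 subring_scaleDr subring_scaleDl.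

Definition subring_submod : {pred over_subring} := fun x : R => x \in S.

Fact subring_submod_closed : submod_closed subring_submod.
Proof.
split=> [|a x y Sx Sy]; first exact: (rpred0 S).
by apply: (rpredD (S := S)) => //; apply: rpredM => //; exact: valP.
Qed.
HB.instance Definition _ := GRing.isSubmodClosed.Build subringtype over_subring
  subring_submod subring_submod_closed.

(* R/S as an S-module. *)
Definition subring_quot := quotmod (subring_submod : submodClosed over_subring).

(* R is module-finite over S, Q(S) = Q(R) (a total quotient ring of R is one
   of S along the inclusion), and S is Gorenstein. *)
Definition birational_gorenstein_subring :=
  [/\ finitely_generated over_subring,
      exists (Q : comNzRingType) (phi : {rmorphism R -> Q}),
        is_localization (@nonzerodivisors R) phi /\
        is_localization (@nonzerodivisors subringtype) (phi \o subring_incl)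
    & gorenstein subringtype].

End Subrings.

Definition bg (R : comNzRingType) : enat :=
  enat_inf [set l | exists S : subringClosed R,
    birational_gorenstein_subring S /\ l = module_length (subring_quot S)].

(* Main.v *)
From HB Require Import structures.
Require Import Defs.
From mathcomp Require Import all_boot all_algebra ring_quotient.
From mathcomp Require Import generic_quotient boolp classical_sets functions.
From mathcomp Require Import ring zify.

(** Let S be a Gorenstein subring of R, birational and module-finite, with
    n the length of R/S, and let c = (S : R) be the conductor. The canonical
    module of R is Hom_S(R, S) = c, so there is an R-linear map from omega onto
    the ideal c of R. Duality over S gives that S/c and R/S have the same
    length, hence R/c has length at most 2n.

    Fix a nonzerodivisor y of R in m with yR in S. Everything is reduced to
    the Artinian rings R/y and S/y^N by the following facts.

    - If M has a finite injective resolution, then Ext^i(R/J, M) = 0 for i > 1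
      and all ideals J that contain y (finite_cosyzygy_baer). For M = S this
      makes S/y^N self-injective (finite_injdim_selfinjective). For M = omega
      it makes a socle element of R/y divide every socle element of omega/y
      (finite_injdim_socle), which forces omega to be faithful.

    - As omega has type 1, the socle of omega/y is one-dimensional
      (type1_socle).

    - If M is a finitely generated S-module without y-torsion, then S-linear
      functionals from M to S separate the elements of M/yM (rV_functional):
      functionals to S/y^N exist because S/y^N is self-injective, and they can
      be corrected to functionals to S by an Artin-Rees argument. If M is an
      R-module, then such a functional is R-linear with values in c
      (conductor_functional).

    A functional h on omega that does not vanish modulo y on the socle of
    omega/y is injective from omega/y to c/y. Its image I is then a faithful
    ideal and c/I has no y-torsion. If I were not c, then R/I would have a
    quotient without y-torsion, with a functional whose value a at 1 is not
    zero; but a I = 0. Therefore h maps onto c (canonical_onto_conductor).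

    For the lengths, a chain of ideals B between c and R gives two chains of
    S-modules between S and R, formed by B + S and by (S : B \cap S). One of
    them is strict wherever the chain of ideals is (colon_strict), and each has
    at most n strict steps. *)

Set Implicit Arguments.
Unset Strict Implicit.
Unset Printing Implicit Defensive.

Import GRing.Theory.
Local Open Scope classical_set_scope.
Local Open Scope ring_scope.
Local Open Scope quotient_scope.

(** * Ideals of a Noetherian ring *)

Section Ideals.
Variable R : comNzRingType.
Implicit Types (J : set R) (a b u v : R).

Definition is_ideal J := J 0 /\ forall a u v, J u -> J v -> J (a * u + v).

Lemma is_idealMl J a u : is_ideal J -> J u -> J (a * u).
Proof. by case=> J0 JD Ju; rewrite -[_ * _]addr0; apply: JD. Qed.

Lemma is_idealD J u v : is_ideal J -> J u -> J v -> J (u + v).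
Proof. by case=> J0 JD Ju Jv; rewrite -[u]mul1r; apply: JD. Qed.

Lemma is_idealB J u v : is_ideal J -> J u -> J v -> J (u - v).
Proof. by case=> J0 JD Ju Jv; rewrite addrC -mulN1r; apply: JD. Qed.

Lemma is_ideal_sum J n (c e : 'I_n -> R) :
  is_ideal J -> (forall i, J (e i)) -> J (\sum_i c i * e i).
Proof.
move=> idJ Je; elim/big_ind: _ => [|u v|i _]; first by case: idJ.
- exact: is_idealD.
- exact: is_idealMl.
Qed.

Lemma idealr_is_ideal (I : idealr R) : is_ideal [set a | a \in I].
Proof.
split=> [|a u v /= Iu Iv]; first exact: idealr0.
by apply: rpredD => //; apply: idealMr.
Qed.

Definition adjoin J u : set R := [set a | exists j r, J j /\ a = j + r * u].

Lemma adjoin_ideal J u : is_ideal J -> is_ideal (adjoin J u).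
Proof.
move=> idJ; split; first by exists 0, 0; split; [case: idJ | ring].
move=> a _ _ [j [r [Jj ->]]] [k [s [Jk ->]]].
exists (a * j + k), (a * r + s); split; last by ring.
by case: idJ => _; apply.
Qed.

Lemma adjoin_sub J u a : J a -> adjoin J u a.
Proof. by move=> Ja; exists a, 0; split=> //; ring. Qed.

Lemma adjoin_gen J u : is_ideal J -> adjoin J u u.
Proof. by case=> J0 _; exists 0, 1; split=> //; ring. Qed.

Definition principal y : set R := [set a | exists r, a = y * r].

Lemma principal_ideal y : is_ideal (principal y).
Proof.
split; first by exists 0; ring.
by move=> a _ _ [r ->] [s ->]; exists (a * r + s); ring.
Qed.

Lemma principal_gen y : principal y y.
Proof. by exists 1; ring. Qed.

Section IdealrOf.
Variables (J : set R) (idJ : is_ideal J) (J1 : ~ J 1).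

Definition idealr_of_pred : {pred R} := fun a => `[< J a >].

Fact idealr_of_closed : idealr_closed idealr_of_pred.
Proof.
split; [by apply/asboolP; case: idJ | by apply/asboolP |].
by move=> a u v /asboolP Ju /asboolP Jv; apply/asboolP; case: idJ => _; apply.
Qed.

HB.instance Definition _ := isIdealr.Build R idealr_of_pred idealr_of_closed.

Definition idealr_of : idealr R := idealr_of_pred.

Lemma idealr_ofE a : (a \in idealr_of) = `[< J a >]. Proof. by []. Qed.

End IdealrOf.

Section PrimeIdealrOf.
Variables (J : set R) (idJ : is_ideal J) (J1 : ~ J 1).
Hypothesis primeJ : forall u v, J (u * v) -> J u \/ J v.

Definition prime_idealr_of_pred : {pred R} := fun a => `[< J a >].

Fact prime_idealr_of_closed : prime_idealr_closed prime_idealr_of_pred.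
Proof.
move=> u v /asboolP Juv; apply/orP.
by case: (primeJ Juv) => ?; [left | right]; apply/asboolP.
Qed.

HB.instance Definition _ := isIdealr.Build R prime_idealr_of_pred
  (idealr_of_closed idJ J1).
HB.instance Definition _ := isPrimeIdealrClosed.Build R prime_idealr_of_pred
  prime_idealr_of_closed.

Definition prime_idealr_of : prime_idealr R := prime_idealr_of_pred.

Lemma prime_idealr_ofE a : (a \in prime_idealr_of) = `[< J a >].
Proof. by []. Qed.

End PrimeIdealrOf.

Hypothesis noethR : noetherian R.

Lemma noetherian_fg J : is_ideal J ->
  exists (n : nat) (e : 'I_n -> R),
    forall x, J x <-> exists c : 'I_n -> R, x = \sum_i c i * e i.
Proof.
move=> idJ; case: (pselect (J 1)) => [J1|J1].
  exists 1%N, (fun=> 1) => x; split=> [_|_].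
    by exists (fun=> x); rewrite big_ord1 mulr1.
  by rewrite -[x]mulr1; apply: is_idealMl.
have [n [e He]] := noethR (idealr_of idJ J1).
by exists n, e => x; rewrite -He idealr_ofE; split=> [?|/asboolP //]; apply/asboolP.
Qed.

Lemma noetherian_chain (J : nat -> set R) :
  (forall n, is_ideal (J n)) -> (forall n a, J n a -> J n.+1 a) ->
  exists n, forall k a, J k a -> J n a.
Proof.
move=> idJ incJ.
have mono k l a : (k <= l)%N -> J k a -> J l a.
  by move=> /subnK <-; elim: (l - k)%N => //= i IH /IH; apply: incJ.
have idU : is_ideal [set a | exists n, J n a].
  split; first by exists 0%N; case: (idJ 0%N).
  move=> a u v /= [k Jk] [l Jl]; exists (maxn k l).
  by case: (idJ (maxn k l)) => _; apply;
    [apply: mono Jk | apply: mono Jl]; rewrite ?leq_maxl ?leq_maxr.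
have [p [e He]] := noetherian_fg idU.
have Ue i : exists n, J n (e i).
  apply/(He _); exists (fun j => (j == i)%:R).
  rewrite (bigD1 i) //= eqxx mul1r big1 ?addr0 // => j /negPf ->.
  by rewrite mul0r.
have [f Hf] := choice Ue.
exists (\max_i f i) => k a Jka.
have /(He _) [c ->] : exists n, J n a by exists k.
by apply: is_ideal_sum => // i; apply: mono (Hf i); apply: leq_bigmax.
Qed.

Lemma noetherian_max (F : set (set R)) :
  (forall J, F J -> is_ideal J) -> (exists J, F J) ->
  exists2 J, F J & forall J', F J' -> (forall a, J a -> J' a) ->
    forall a, J' a -> J a.
Proof.
move=> idF [J0 FJ0]; apply: contrapT => nomax.
have step (J : {J | F J}) : exists J' : {J | F J},
    (forall a, sval J a -> sval J' a) /\ exists2 a, sval J' a & ~ sval J a.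
  case: J => J FJ /=; apply: contrapT => H; apply: nomax; exists J => //.
  move=> J' FJ' sub a J'a; apply: contrapT => nJa; apply: H.
  by exists (exist _ J' FJ'); split=> //; exists a.
have [s Hs] := choice step.
pose J n := sval (iter n s (exist _ J0 FJ0)).
have [n Hn] : exists n, forall k a, J k a -> J n a.
  apply: noetherian_chain => n; first by apply: idF; apply: svalP.
  by move=> a; rewrite /J /=; case: (Hs (iter n s (exist _ J0 FJ0))) => H _; apply: H.
case: (Hs (iter n s (exist _ J0 FJ0))) => _ [a Ja []].
by apply: (Hn n.+1).
Qed.

(** An ideal that is maximal among those missing a multiplicative set is
    prime. *)
Lemma exists_prime_disjoint J (W : set R) :
  is_ideal J -> W 1 -> (forall u v, W u -> W v -> W (u * v)) ->
  (forall a, W a -> ~ J a) ->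
  exists p : prime_idealr R,
    (forall a, J a -> a \in p) /\ (forall a, W a -> a \notin p).
Proof.
move=> idJ W1 WM JW.
pose F : set (set R) := [set K | [/\ is_ideal K, forall a, J a -> K a
                                   & forall a, W a -> ~ K a]].
have [||P [idP JP WP] maxP] := @noetherian_max F.
- by move=> K [].
- by exists J; split.
have hit u : ~ P u -> exists2 w, W w & adjoin P u w.
  move=> Pu; apply: contrapT => H; apply: Pu; apply: (maxP (adjoin P u)).
  - split; first exact: adjoin_ideal.
      by move=> a Ja; apply: adjoin_sub; apply: JP.
    by move=> w Ww Pw; apply: H; exists w.
  - by move=> a; apply: adjoin_sub.
  - exact: adjoin_gen.
have primeP u v : P (u * v) -> P u \/ P v.
  move=> Puv; apply: contrapT => /not_orP[Pu Pv].
  have [w Ww [j [r [Pj wE]]]] := hit u Pu.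
  have [w' Ww' [k [s [Pk w'E]]]] := hit v Pv.
  apply: (WP _ (WM _ _ Ww Ww')).
  have -> : w * w' = w' * j + (r * u * k + (r * s) * (u * v)).
    by rewrite wE w'E; ring.
  case: (idP) => _ PD; apply: (PD) => //; apply: is_idealD => //;
    exact: is_idealMl.
exists (prime_idealr_of idP (WP _ W1) primeP); split=> a Ha.
  by rewrite prime_idealr_ofE; apply/asboolP; apply: JP.
by rewrite prime_idealr_ofE; apply/asboolP; apply: WP.
Qed.

End Ideals.

(** * Parameters of one-dimensional local rings *)

(** What dimension one contributes to the proof, in a form that passes to the
    powers of [y] and to subrings: by the last condition R/yR is Artinian. *)
Record regular_parameter (R : comNzRingType) (m : set R) (y : R) : Prop := {
  rp_noetherian : noetherian R;
  rp_ideal : is_ideal m;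
  rp_proper : ~ m 1;
  rp_unit : forall a, ~ m a -> exists b, a * b = 1;
  rp_mem : m y;
  rp_regular : forall b, y * b = 0 -> b = 0;
  rp_power : forall a, m a -> exists N, principal y (a ^+ N)
}.

Section RegularParameter.
Variables (R : comNzRingType) (m : set R) (y : R).
Hypothesis par : regular_parameter m y.
Implicit Types (J : set R) (a b u v : R).

Lemma rp_mulI a b : y * a = y * b -> a = b.
Proof.
move=> eq_ab; apply/eqP; rewrite -subr_eq0; apply/eqP.
by apply: (rp_regular par); rewrite mulrBr eq_ab subrr.
Qed.

Lemma rp_proper_sub J a : is_ideal J -> ~ J 1 -> J a -> m a.
Proof.
move=> idJ J1 Ja; apply: contrapT => /(rp_unit par)[b ab1]; apply: J1.
by rewrite -ab1 mulrC; apply: is_idealMl.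
Qed.

Lemma rp_1B a : m a -> exists b, (1 - a) * b = 1.
Proof.
move=> ma; apply: (rp_unit par) => m1; apply: (rp_proper par).
by rewrite -[1](subrK a); apply: is_idealD (rp_ideal par) _ _.
Qed.

Lemma rp_expr N : regular_parameter m (y ^+ N.+1).
Proof.
case: (par) => nR idm m1 mU my yreg ypow; split=> //.
- by rewrite exprSr; apply: is_idealMl.
- elim: N => [b|N IH b]; first by rewrite expr1; apply: yreg.
  by rewrite exprS -mulrA => /yreg /IH.
- move=> a /ypow [k [r ykr]]; exists (k * N.+1)%N, (r ^+ N.+1).
  by rewrite exprM ykr exprMn.
Qed.

(** All associated primes of R/J equal [m]: a maximal member of the family of
    the ideals (J : u), u outside J, is prime, contains y, and hence contains
    every element of [m]. *)
Lemma exists_socle J : is_ideal J -> J y -> ~ J 1 ->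
  exists u, ~ J u /\ forall a, m a -> J (a * u).
Proof.
move=> idJ Jy J1.
pose F : set (set R) := [set K | exists2 u, ~ J u & K = [set a | J (a * u)]].
have colon_ideal u : is_ideal [set a | J (a * u)].
  split=> /= [|a b c Jb Jc]; first by rewrite mul0r; case: idJ.
  by rewrite mulrDl -mulrA; case: idJ => _; apply.
have [||_ [u Ju ->] max_u] := noetherian_max (rp_noetherian par) (F := F).
- by move=> _ [u _ ->].
- by exists [set a | J (a * 1)], 1.
have prime_u a b : J (a * b * u) -> ~ J (b * u) -> J (a * u).
  move=> Jabu Jbu.
  apply: (max_u [set c | J (c * (b * u))]) => [|c /= Jc|/=].
  - by exists (b * u).
  - by rewrite mulrCA; apply: is_idealMl.
  - by rewrite mulrA.
exists u; split=> // a ma.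
have [N [r aNyr]] := rp_power par ma.
have : J (a ^+ N * u).
  by rewrite aNyr -mulrA mulrC; apply: is_idealMl.
elim: N {aNyr} => [|N IH]; first by rewrite expr0 mul1r.
rewrite exprS => JaN; case: (pselect (J (a ^+ N * u))) => [/IH //|].
exact: prime_u.
Qed.

Lemma principal_proper : ~ principal y 1.
Proof.
by case=> r r1; apply: (rp_proper par); rewrite r1 mulrC;
  apply: is_idealMl (rp_ideal par) (rp_mem par).
Qed.

Lemma exists_socle_principal :
  exists s, ~ principal y s /\ forall a, m a -> principal y (a * s).
Proof.
exact: exists_socle (principal_ideal y) (principal_gen y) principal_proper.
Qed.

(** Krull's intersection theorem for the y-adic topology of R/I, phrased for a
    subset [P] with P = yP modulo I. *)
Lemma y_divisible_sub (I P : set R) : is_ideal I ->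
  (forall a, P a -> exists2 b, P b & I (a - y * b)) -> forall a, P a -> I a.
Proof.
move=> idI divP a Pa.
have step (b : {b | P b}) : exists c : {c | P c}, I (sval b - y * sval c).
  by case: b => b /= /divP [c Pc Ic]; exists (exist _ c Pc).
have [s Hs] := choice step.
pose u n := sval (iter n s (exist _ a Pa)).
have Iu n : I (u n - y * u n.+1) by exact: Hs.
have [n Hn] : exists n, forall k a, adjoin I (u k) a -> adjoin I (u n) a.
  apply: (noetherian_chain (rp_noetherian par) (J := fun k => adjoin I (u k))) => k.
    exact: adjoin_ideal.
  move=> _ [j [r [Ij ->]]]; exists (j + r * (u k - y * u k.+1)), (r * y).
  split; last by ring.
  by apply: is_idealD => //; apply: is_idealMl.
have [j [r [Ij ujr]]] := Hn n.+1 _ (adjoin_gen (u n.+1) idI).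
have [b yb] : exists b, (1 - r * y) * b = 1.
  by apply: rp_1B; apply: is_idealMl (rp_ideal par) (rp_mem par).
have Iu1 : I (u n.+1).
  have -> : u n.+1 = b * ((1 - r * y) * u n.+1).
    by rewrite mulrA [b * _]mulrC yb mul1r.
  apply: is_idealMl => //.
  have -> : (1 - r * y) * u n.+1 = j + r * (u n - y * u n.+1).
    by rewrite {1}mulrBl mul1r {1}ujr; ring.
  by apply: is_idealD => //; apply: is_idealMl.
elim: n.+1 Iu1 => // k IH Ik; apply: IH; rewrite -[u k](subrK (y * u k.+1)).
by apply: is_idealD => //; apply: is_idealMl.
Qed.

End RegularParameter.

(** * Injective modules and finite injective resolutions *)

Section Injective.
Variable R : comNzRingType.
Implicit Types (J : set R) (a s t u : R).

Definition linear_on J (M : lmodType R) (g : R -> M) :=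
  forall a u v, J u -> J v -> g (a * u + v) = a *: g u + g v.

Lemma linear_on0 J (M : lmodType R) (g : R -> M) :
  is_ideal J -> linear_on J g -> g 0 = 0.
Proof.
move=> [J0 _] /(_ (-1) 0 0 J0 J0).
by rewrite mulr0 addr0 scaleN1r addNr.
Qed.

Lemma linear_onZ J (M : lmodType R) (g : R -> M) a u :
  is_ideal J -> linear_on J g -> J u -> g (a * u) = a *: g u.
Proof.
move=> idJ lin_g Ju; rewrite -[_ * _]addr0 lin_g ?(linear_on0 idJ lin_g) ?addr0 //.
by case: idJ.
Qed.

Section IdealSubmodule.
Variables (J : set R) (idJ : is_ideal J).

Definition ideal_submod_pred : {pred R^o} := fun a => `[< J a >].

Fact ideal_submod_closed : submod_closed ideal_submod_pred.
Proof.
split; first by apply/asboolP; case: idJ.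
by move=> a u v /asboolP Ju /asboolP Jv; apply/asboolP; case: idJ => _; apply.
Qed.

HB.instance Definition _ :=
  GRing.isSubmodClosed.Build R R^o ideal_submod_pred ideal_submod_closed.

Definition ideal_submod : submodClosed R^o := ideal_submod_pred.

End IdealSubmodule.

(** The easy half of Baer's criterion. *)
Lemma injective_baer (E : lmodType R) J (g : R -> E) :
  injective_module E -> is_ideal J -> linear_on J g ->
  exists e, forall t, J t -> g t = t *: e.
Proof.
move=> injE idJ lin_g; pose A := submodtype (ideal_submod idJ).
have JA (x : A) : J (val x) by apply/asboolP; apply: (valP x).
have lin_i : linear (val : A -> R^o) by [].
have lin_f : linear (fun x : A => g (val x)) by move=> a x x'; apply: lin_g.
pose i := HB.pack_for {linear A -> R^o} (val : A -> R^o)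
  (GRing.isLinear.Build _ _ _ _ _ lin_i).
pose f := HB.pack_for {linear A -> E} (fun x : A => g (val x))
  (GRing.isLinear.Build _ _ _ _ _ lin_f).
have [h Hh] := injE A R^o i f val_inj.
exists (h (1 : R^o)) => t Jt.
have tA : (t : R^o) \in ideal_submod idJ by apply/asboolP.
have := Hh (SubmodType tA); rewrite /f /i /= => <-.
by rewrite -linearZ /=; congr (h _); rewrite -[RHS]/(t * 1) mulr1.
Qed.

Lemma injective_divisible (E : lmodType R) y (z : E) :
  injective_module E -> (forall b, y * b = 0 -> b = 0) ->
  exists z', y *: z' = z.
Proof.
move=> injE yreg.
have lin_i : linear (fun r : R^o => y * r : R^o).
  by move=> a u v; rewrite -![_ *: _]/(_ * _); ring.
have lin_f : linear (fun r : R^o => (r : R) *: z).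
  by move=> a u v; rewrite scalerDl scalerA.
pose i := HB.pack_for {linear R^o -> R^o} (fun r : R^o => y * r : R^o)
  (GRing.isLinear.Build _ _ _ _ _ lin_i).
pose f := HB.pack_for {linear R^o -> E} (fun r : R^o => (r : R) *: z)
  (GRing.isLinear.Build _ _ _ _ _ lin_f).
have inj_i : injective i.
  move=> u v /= /eqP; rewrite -subr_eq0 -mulrBr => /eqP/yreg/eqP.
  by rewrite subr_eq0 => /eqP.
have [h Hh] := injE R^o R^o i f inj_i.
exists (h (1 : R^o)); rewrite -linearZ /=.
by have := Hh 1; rewrite /f /i /= scale1r => <-.
Qed.

Variables (m : set R) (y : R).
Hypothesis par : regular_parameter m y.

Section Cosyzygy.
Variables (M : lmodType R) (I : injective_resolution M).

(** The vanishing of Ext^{j+2}(R/J, M) for all ideals J that contain [y],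
    written as Ext^1(R/J, C) = 0 for the cosyzygy C, which is the kernel of the
    differential on I_{j+1}. *)
Definition cosyzygy_baer j :=
  forall J (g : R -> ir_obj I j.+1), is_ideal J -> J y -> linear_on J g ->
  (forall t, J t -> ir_d I j.+1 (g t) = 0) ->
  exists2 e, ir_d I j.+1 e = 0 & forall t, J t -> g t = t *: e.

(** It is enough to extend maps that are defined on the maximal ideal: an
    ideal J that is maximal among those with a map that does not extend would
    have u outside J with mu in J, and a map on J extends to J + Ru. *)
Lemma cosyzygy_baer_max j :
  (forall g : R -> ir_obj I j.+1, linear_on m g ->
     (forall t, m t -> ir_d I j.+1 (g t) = 0) ->
     exists2 e, ir_d I j.+1 e = 0 & forall t, m t -> g t = t *: e) ->
  cosyzygy_baer j.
Proof.
move=> ext_m; pose ext (J : set R) := forall g : R -> ir_obj I j.+1,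
  linear_on J g -> (forall t, J t -> ir_d I j.+1 (g t) = 0) ->
  exists2 e, ir_d I j.+1 e = 0 & forall t, J t -> g t = t *: e.
suff all_ext J : is_ideal J -> J y -> ext J by move=> J g idJ Jy; apply: all_ext.
move=> idJ Jy; apply: contrapT => notext.
have [|| {notext}J' [{}idJ {}Jy notext] maxJ] := noetherian_max (rp_noetherian par)
  (F := [set J | [/\ is_ideal J, J y & ~ ext J]]).
- by move=> K [].
- by exists J.
move: {J} J' idJ Jy notext maxJ => J idJ Jy notext maxJ; apply: notext => g lin_g dg.
case: (pselect (J 1)) => J1.
  exists (g 1); first exact: dg.
  by move=> t Jt; rewrite -(linear_onZ _ idJ lin_g J1) mulr1.
have [u [Ju mu]] := exists_socle par idJ Jy J1.
have colon_m r : J (r * u) -> m r.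
  move=> Jru; apply: contrapT => /(rp_unit par) [b rb1]; apply: Ju.
  by rewrite -[u]mul1r -rb1 [r * b]mulrC -mulrA; apply: is_idealMl.
have lin_gu : linear_on m (fun a => g (a * u)).
  by move=> a r r' mr mr'; rewrite mulrDl -mulrA lin_g //; apply: mu.
have [|e de He] := ext_m _ lin_gu; first by move=> t mt; apply/dg/mu.
have rep t : {p : R * R | adjoin J u t -> J p.1 /\ t = p.1 + p.2 * u}.
  apply: cid; case: (pselect (adjoin J u t)) => [[k [r ?]]|Ht]; last by exists (0, 0).
  by exists (k, r).
pose g' t := g (sval (rep t)).1 + (sval (rep t)).2 *: e.
have g'E k r : J k -> g' (k + r * u) = g k + r *: e.
  move=> Jk; rewrite /g'; case: (rep _) => -[k' r'] /= [|Jk' eq_t].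
    by exists k, r.
  have dE : (r' - r) * u = k - k'.
    by rewrite -[k](addrK (r * u)) eq_t; ring.
  have mr : m (r' - r) by apply: colon_m; rewrite dE; apply: is_idealB.
  have kE : k = (r' - r) * u + k' by rewrite dE subrK.
  have Je : g ((r' - r) * u) = (r' - r) *: e by rewrite He.
  rewrite {1}kE -[(r' - r) * u]mul1r lin_g ?scale1r ?Je //; last exact: mu.
  by rewrite scalerBl addrAC subrK addrC.
have lin_g' : linear_on (adjoin J u) g'.
  move=> a _ _ [k [r [Jk ->]]] [k' [r' [Jk' ->]]].
  have -> : a * (k + r * u) + (k' + r' * u) = (a * k + k') + (a * r + r') * u.
    by ring.
  rewrite !g'E ?lin_g //; last by case: idJ => _; apply.
  by rewrite scalerDl !scalerDr scalerA addrACA.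
have dg' t : adjoin J u t -> ir_d I j.+1 (g' t) = 0.
  by case=> [k [r [Jk ->]]]; rewrite g'E // linearD dg // linearZ /= de scaler0 addr0.
have [e' de' He'] : exists2 e, ir_d I j.+1 e = 0
    & forall t, adjoin J u t -> g' t = t *: e.
  apply: contrapT => Hne; apply: Ju; apply: (maxJ (adjoin J u)).
  - split; [exact: adjoin_ideal | exact: adjoin_sub |].
    by move/(_ g' lin_g' dg').
  - by move=> t; apply: adjoin_sub.
  - exact: adjoin_gen.
exists e' => // t Jt; rewrite -He'; last exact: adjoin_sub.
by have := g'E t 0 Jt; rewrite mul0r scale0r !addr0.
Qed.

(** The map with [s] to [e] and [y] to 0 is well defined on (s, y) when [s]
    represents a socle element of R/y and [m] kills [e]. *)
Lemma socle_extension j s (e : ir_obj I j.+1) :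
  cosyzygy_baer j -> ~ principal y s -> ir_d I j.+1 e = 0 ->
  (forall a, m a -> a *: e = 0) ->
  exists b : ir_obj I j.+1, [/\ ir_d I j.+1 b = 0, y *: b = 0 & e = s *: b].
Proof.
move=> baer ys de me.
have rep t : {r : R | adjoin (principal y) s t -> principal y (t - r * s)}.
  apply: cid; case: (pselect (adjoin (principal y) s t)) => [[k [r [yk ->]]]|].
    by exists r => _; rewrite addrK.
  by exists 0.
pose g t := sval (rep t) *: e.
have colon_m r : principal y (r * s) -> m r.
  move=> yrs; apply: contrapT => /(rp_unit par) [b rb1]; apply: ys.
  rewrite -[s]mul1r -rb1 [r * b]mulrC -mulrA.
  by apply: is_idealMl => //; apply: principal_ideal.
have gE k r : principal y k -> g (k + r * s) = r *: e.
  move=> yk; rewrite /g; case: (rep _) => r' /= [|k' Hk'].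
    by exists k, r.
  have mr : m (r - r').
    apply: colon_m; rewrite (_ : _ * s = y * k' - k).
      apply: is_idealB (principal_ideal y) _ yk; by exists k'.
    by rewrite -Hk'; ring.
  by apply/eqP; rewrite -subr_eq0 -opprB -scalerBl me ?oppr0.
have lin_g : linear_on (adjoin (principal y) s) g.
  move=> a _ _ [k [r [yk ->]]] [k' [r' [yk' ->]]].
  have -> : a * (k + r * s) + (k' + r' * s) = (a * k + k') + (a * r + r') * s.
    by ring.
  rewrite !gE //; first by rewrite scalerDl scalerA.
  by case: (principal_ideal y) => _; apply.
have gs : g s = e.
  by have := gE 0 1 (proj1 (principal_ideal y)); rewrite add0r mul1r scale1r.
have gy : g y = 0.
  by have := gE y 0 (principal_gen y); rewrite mul0r addr0 scale0r.
have [||b db Hb] := baer _ g (adjoin_ideal s (principal_ideal y)) _ lin_g.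
- exact/adjoin_sub/principal_gen.
- by move=> t [k [r [yk ->]]]; rewrite gE // linearZ /= de scaler0.
exists b; split=> //; first by rewrite -Hb ?gy //; apply/adjoin_sub/principal_gen.
by rewrite -Hb ?gs //; apply/adjoin_gen/principal_ideal.
Qed.

(** A map from [m] to the kernel of the differential on I_{j+1} is
    multiplication by some [e] in I_{j+1}. The differential of [e] is killed by
    [m], hence of the form s b with y b = 0, and [b] lifts to some [b'] with
    y b' = 0, since multiplication by [y] is onto on I_j. Then e - s b' is in
    the kernel, and multiplication by it is the same map on [m], because ms is
    in yR. *)
Lemma cosyzygy_baer_step j : cosyzygy_baer j.+1 -> cosyzygy_baer j.
Proof.
move=> baer; apply: cosyzygy_baer_max => g lin_g dg.
have [e He] := injective_baer (@ir_injective _ _ I j.+1) (rp_ideal par) lin_g.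
have [s [ys ms]] := exists_socle_principal par.
have [||b [db yb eb]] := socle_extension baer ys (e := ir_d I j.+1 e).
- by apply/ir_exactS; exists e.
- by move=> a ma; rewrite -linearZ /= -He // dg.
have [b1 b1E] : exists b1, ir_d I j.+1 b1 = b by apply/ir_exactS.
have [b2 b2E] : exists b2, ir_d I j b2 = y *: b1.
  by apply/ir_exactS; rewrite linearZ /= b1E.
have [b3 b3E] := injective_divisible b2 (@ir_injective _ _ I j) (rp_regular par).
pose b' := b1 - ir_d I j b3.
have yb' : y *: b' = 0 by rewrite scalerBr -linearZ /= b3E b2E subrr.
have db' : ir_d I j.+1 b' = b.
  rewrite linearB /= b1E (_ : ir_d I j.+1 (ir_d I j b3) = 0) ?subr0 //.
  by apply/ir_exactS; exists b3.
exists (e - s *: b'); first by rewrite linearB linearZ /= db' -eb subrr.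
move=> t mt; rewrite He // scalerBr scalerA.
have [r ->] := ms _ mt.
by rewrite mulrC -scalerA yb' scaler0 subr0.
Qed.

(** Induction downwards from the end of the resolution, where the cosyzygy
    is zero. *)
Lemma finite_cosyzygy_baer n :
  (forall i, (n < i)%N -> forall x : ir_obj I i, x = 0) -> forall j, cosyzygy_baer j.
Proof.
move=> I0; suff H k j : (n < j.+1 + k)%N -> cosyzygy_baer j.
  by move=> j; apply: (H n); rewrite addSn ltnS leq_addl.
elim: k j => [|k IH] j; last first.
  by rewrite addnS -addSn => /IH; apply: cosyzygy_baer_step.
rewrite addn0 => /I0 Ij0 J g idJ Jy _ _.
exists 0 => [|t _]; first exact: linear0.
by rewrite scaler0; apply: Ij0.
Qed.

End Cosyzygy.

(** The ring R/y is injective over itself, in Baer's form; the elements of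
    R/y are given by representatives in R. *)
Definition selfinjective_mod :=
  forall J (g : R -> R), is_ideal J -> J y ->
  (forall a u v, J u -> J v -> principal y (g (a * u + v) - (a * g u + g v))) ->
  principal y (g y) -> exists b, forall t, J t -> principal y (g t - t * b).

(** In an injective resolution of R write the image of 1 as y v and put
    e = d v, so that y e = 0: a map g from J to R/y gives the map
    t |-> g(t) e from J to the first cosyzygy. *)
Lemma finite_injdim_selfinjective :
  finite_injdim (R^o : lmodType R) -> selfinjective_mod.
Proof.
case=> I [n I0] J g idJ Jy lin_g gy.
have baer : cosyzygy_baer I 0 by apply: finite_cosyzygy_baer I0 _.
have [v vE] := injective_divisible (ir_aug I (1 : R^o))
  (@ir_injective _ _ I 0%N) (rp_regular par).
have augZ r : r *: ir_aug I 1 = ir_aug I (r : R^o).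
  by rewrite -linearZ /=; congr (ir_aug I _); rewrite -[LHS]/(r * 1) mulr1.
pose e := ir_d I 0%N v.
have ye r : principal y r -> r *: e = 0.
  case=> c ->; rewrite mulrC -scalerA (_ : y *: e = 0) ?scaler0 //.
  by rewrite -linearZ /= vE; apply/ir_exact0; exists 1.
have [||e' de' He'] := baer J (fun t => g t *: e) idJ Jy.
- move=> a r r' Jr Jr'; apply/eqP; rewrite -subr_eq0 scalerA -scalerDl -scalerBl.
  by rewrite ye //; apply: lin_g.
- move=> t _; rewrite linearZ /= (_ : ir_d I 1 e = 0) ?scaler0 //.
  by apply/ir_exactS; exists v.
have [v' v'E] : exists v', ir_d I 0 v' = e' by apply/ir_exactS.
have [b bE] : exists b, ir_aug I b = y *: v'.
  by apply/ir_exact0; rewrite linearZ /= v'E -He' // ye.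
exists b => t Jt.
have [c cE] : exists c, ir_aug I c = g t *: v - t *: v'.
  apply/ir_exact0; rewrite linearB !linearZ /= v'E scalerN -He' //; exact: subrr.
exists c; apply: (@ir_aug_inj _ _ I).
have -> : ir_aug I (y * c) = y *: ir_aug I c by rewrite -linearZ.
rewrite cE scalerBr !scalerA [y * g t]mulrC -[_ *: v]scalerA vE augZ.
rewrite [y * t]mulrC -[_ *: v']scalerA -bE.
by rewrite -linearZ /= -linearB.
Qed.

Section Socle.
Variable M : lmodType R.
Hypothesis My : forall w : M, y *: w = 0 -> w = 0.
Implicit Types w : M.

Definition socle_mod w := forall a, m a -> exists w', a *: w = y *: w'.

(** The element w/y of the localization of M, realized in I_0: the assignment
    a |-> aw/y is a linear map from [m] to M. *)
Lemma socle_quotient (I : injective_resolution M) w : socle_mod w ->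
  exists2 v : ir_obj I 0%N, y *: v = ir_aug I w
    & forall a, m a -> exists w', a *: v = ir_aug I w'.
Proof.
move=> mw.
have rep a : {w' | m a -> a *: w = y *: w'}.
  by apply: cid; case: (pselect (m a)) => [/mw [w' ?]|?]; [exists w' | exists 0].
pose q a := sval (rep a).
have qE a : m a -> y *: q a = a *: w.
  by move=> ma; rewrite /q; case: (rep a) => w' /= ->.
have lin_q : linear_on m (fun a => ir_aug I (q a)).
  move=> a u v mu mv; rewrite -linearP; congr (ir_aug I _).
  apply/eqP; rewrite -subr_eq0; apply/eqP/My.
  rewrite scalerBr scalerDr scalerA [y * a]mulrC -[_ *: q u]scalerA !qE //; last first.
    by case: (rp_ideal par) => _; apply.
  by rewrite scalerDl scalerA subrr.
have [v Hv] := injective_baer (@ir_injective _ _ I 0%N) (rp_ideal par) lin_q.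
exists v => [|a ma]; last by exists (q a); rewrite -Hv.
rewrite -Hv; last exact: (rp_mem par).
congr (ir_aug I _); apply/eqP; rewrite -subr_eq0; apply/eqP/My.
by rewrite scalerBr qE ?subrr //; exact: (rp_mem par).
Qed.

(** Socle elements of M/yM are divisible by every socle element [s] of R/y,
    as for an injective module over R/y: the class of w/y in the first cosyzygy
    I_0/M is killed by [m] and is therefore s times an element killed by
    [y]. *)
Lemma finite_injdim_socle s w : finite_injdim M ->
  ~ principal y s -> (forall a, m a -> principal y (a * s)) ->
  socle_mod w -> exists v v', w = s *: v + y *: v'.
Proof.
case=> I [n I0] ys ms mw; have baer : cosyzygy_baer I 0 by apply: finite_cosyzygy_baer I0 _.
have [v vE mv] := socle_quotient I mw.
have [||b [db yb eb]] := socle_extension baer ys (e := ir_d I 0%N v).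
- by apply/ir_exactS; exists v.
- move=> a /mv [w' w'E]; rewrite -linearZ /= w'E.
  by apply/ir_exact0; exists w'.
have [v' v'E] : exists v', ir_d I 0%N v' = b by apply/ir_exactS.
have [w1 w1E] : exists w1, ir_aug I w1 = y *: v'.
  by apply/ir_exact0; rewrite linearZ /= v'E.
have [w2 w2E] : exists w2, ir_aug I w2 = v - s *: v'.
  by apply/ir_exact0; rewrite linearB linearZ /= v'E eb; apply: subrr.
exists w1, w2; apply: (@ir_aug_inj _ _ I).
rewrite linearD !linearZ /= w1E w2E -vE scalerBr !scalerA [s * y]mulrC.
by rewrite addrC subrK.
Qed.

End Socle.

End Injective.

(** * Functionals on finitely generated modules *)

Section Vectors.
Variable S : comNzRingType.
Implicit Types (a b r s t z : S) (k : nat).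

Definition is_submodule k (K : set 'rV[S]_k) :=
  K 0 /\ forall a u v, K u -> K v -> K (a *: u + v).

Lemma is_submoduleZ k (K : set 'rV[S]_k) a u :
  is_submodule K -> K u -> K (a *: u).
Proof. by case=> K0 KD Ku; rewrite -[_ *: _]addr0; apply: KD. Qed.

Lemma is_submoduleD k (K : set 'rV[S]_k) u v :
  is_submodule K -> K u -> K v -> K (u + v).
Proof. by case=> K0 KD Ku Kv; rewrite -[u]scale1r; apply: KD. Qed.

Lemma is_submoduleB k (K : set 'rV[S]_k) u v :
  is_submodule K -> K u -> K v -> K (u - v).
Proof. by case=> K0 KD Ku Kv; rewrite addrC -scaleN1r; apply: KD. Qed.

Lemma is_submodule_mulmx k l (K : set 'rV[S]_k) (u : 'rV_l) (G : 'M_(l, k)) :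
  is_submodule K -> (forall i, K (row i G)) -> K (u *m G).
Proof.
move=> subK KG; rewrite mulmx_sum_row; elim/big_ind: _ => [|v v'|i _].
- by case: subK.
- exact: is_submoduleD.
- exact: is_submoduleZ.
Qed.

Lemma row_mx_scalar_ind k (P : 'rV[S]_(1 + k) -> Prop) :
  (forall t v, P (row_mx t%:M v)) -> forall v, P v.
Proof. by move=> H v; rewrite -[v]hsubmxK [lsubmx v]mx11_scalar. Qed.

Lemma row_mx_scalarP k a t t' (v v' : 'rV[S]_k) :
  a *: row_mx t%:M v + row_mx t'%:M v' = row_mx (a * t + t')%:M (a *: v + v').
Proof. by rewrite scale_row_mx add_row_mx scale_scalar_mx -raddfD. Qed.

Lemma row_mx_scalarZ k a t (v : 'rV[S]_k) :
  a *: row_mx t%:M v = row_mx (a * t)%:M (a *: v).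
Proof. by rewrite scale_row_mx scale_scalar_mx. Qed.

Lemma row_mx_scalar0 k t (v v' : 'rV[S]_k) :
  row_mx t%:M v + row_mx 0 v' = row_mx t%:M (v + v').
Proof. by rewrite add_row_mx addr0. Qed.

Lemma row_col_scalarE k t b (v : 'rV[S]_k) (a : 'cV_k) :
  (row_mx t%:M v *m col_mx b%:M a) 0 0 = t * b + (v *m a) 0 0.
Proof.
by rewrite mul_row_col mxE mul_scalar_mx scale_scalar_mx [_%:M 0 0]mxE eqxx mulr1n.
Qed.

Lemma row_mx_scalarB k t t' (v v' : 'rV[S]_k) :
  row_mx t%:M v - row_mx t'%:M v' = row_mx (t - t')%:M (v - v').
Proof. by rewrite opp_row_mx add_row_mx -raddfB. Qed.

Lemma noetherian_rV k (K : set 'rV[S]_k) :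
  noetherian S -> is_submodule K ->
  exists (l : nat) (G : 'M_(l, k)), forall v, K v <-> exists u, v = u *m G.
Proof.
move=> nS; elim: k K => [|k IH] K subK.
  exists 0%N, 0 => v; rewrite [v]thinmx0; split=> _; last by case: subK.
  by exists 0; rewrite mulmx0.
pose K1 : set 'rV_k := [set v | K (row_mx 0%:M v)].
have [|l [G HG]] := IH K1.
  split; rewrite /K1 /=; first by rewrite raddf0 row_mx0; case: subK.
  move=> a u v Ku Kv; have := (proj2 subK) a _ _ Ku Kv.
  by rewrite row_mx_scalarP mulr0 addr0.
pose J : set S := [set t | exists v, K (row_mx t%:M v)].
have idJ : is_ideal J.
  split; first by exists 0; rewrite raddf0 row_mx0; case: subK.
  move=> a t t' [v Kv] [v' Kv']; exists (a *: v + v').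
  by rewrite -row_mx_scalarP; case: subK => _; apply.
have [p [e He]] := noetherian_fg nS idJ.
have Je i : J (e i).
  apply/He; exists (fun j => (j == i)%:R).
  rewrite (bigD1 i) //= eqxx mul1r big1 ?addr0 // => j /negPf ->.
  by rewrite mul0r.
have [f Hf] := choice Je.
pose F : 'M_(p, 1 + k) := \matrix_i row_mx (e i)%:M (f i).
have KF (u : 'rV_p) : K (u *m F).
  by apply: is_submodule_mulmx => // i; rewrite rowK; apply: Hf.
have mulG0 q (x : 'M_(q, l)) :
    x *m (row_mx 0 G : 'M_(l, 1 + k)) = row_mx 0 (x *m G).
  by rewrite mul_mx_row mulmx0.
exists (p + l)%N, (col_mx F (row_mx 0 G)) => v; split; last first.
  move=> [u ->]; rewrite -[u]hsubmxK mul_row_col; apply: is_submoduleD => //.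
  rewrite mulG0.
  have : K1 (rsubmx u *m G) by apply/HG; exists (rsubmx u).
  by rewrite /K1 /= raddf0.
elim/(@row_mx_scalar_ind k): v => t v Kv.
have /He [c tE] : J t by exists v.
pose u1 := \row_i c i.
have u1F : u1 *m F = row_mx t%:M (rsubmx (u1 *m F)).
  rewrite -[LHS]hsubmxK [lsubmx _]mx11_scalar; congr (row_mx _%:M _).
  rewrite mxE mulmx_sum_row summxE tE; apply: eq_bigr => i _.
  by rewrite mxE rowK row_mxEl !mxE mulr1n.
have /HG [u2 u2E] : K1 (v - rsubmx (u1 *m F)).
  rewrite /K1 /=; have := is_submoduleB subK Kv (KF u1).
  by rewrite {1}u1F row_mx_scalarB subrr.
exists (row_mx u1 u2); rewrite mul_row_col mulG0 -u2E u1F.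
by rewrite row_mx_scalar0 row_mxKr addrC subrK.
Qed.

Section Extension.
Variable z : S.
Hypothesis selfinj : selfinjective_mod z.

Let dvd := principal z.
Let dvd_ideal : is_ideal dvd := principal_ideal z.

(** Baer's criterion for the ring S/z, on submodules of free modules. *)
Lemma selfinjective_rV k (K : set 'rV[S]_k) (g : 'rV[S]_k -> S) :
  is_submodule K -> (forall v, K (z *: v)) ->
  (forall a u v, K u -> K v -> dvd (g (a *: u + v) - (a * g u + g v))) ->
  (forall v, dvd (g (z *: v))) ->
  exists a : 'cV_k, forall v, K v -> dvd (g v - (v *m a) 0 0).
Proof.
elim: k K g => [|k IH] K g subK zK lin_g zg.
  exists 0 => v _; rewrite [v]thinmx0 mulmx0 mxE subr0.
  by have := zg 0; rewrite scaler0.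
have [||||a' Ha'] := IH [set v | K (row_mx 0%:M v)]
  (fun v => g (row_mx 0%:M v)).
- split=> [|a u v Ku Kv]; rewrite /= ?raddf0 ?row_mx0; first by case: subK.
  by have := (proj2 subK) a _ _ Ku Kv; rewrite row_mx_scalarP mulr0 addr0 raddf0.
- by move=> v; have := zK (row_mx 0%:M v); rewrite row_mx_scalarZ mulr0.
- move=> a u v Ku Kv; have := lin_g a _ _ Ku Kv.
  by rewrite row_mx_scalarP mulr0 addr0.
- by move=> v; have := zg (row_mx 0%:M v); rewrite row_mx_scalarZ mulr0.
pose J : set S := [set t | exists v, K (row_mx t%:M v)].
have idJ : is_ideal J.
  split; first by exists 0; rewrite raddf0 row_mx0; case: subK.
  move=> a t t' [v Kv] [v' Kv']; exists (a *: v + v').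
  by rewrite -row_mx_scalarP; case: subK => _; apply.
have rep t : {v : 'rV_k | J t -> K (row_mx t%:M v)}.
  by apply: cid; case: (pselect (J t)) => [[v Kv]|Jt]; [exists v | exists 0].
pose h t := g (row_mx t%:M (sval (rep t))) - (sval (rep t) *m a') 0 0.
have hE t v : K (row_mx t%:M v) ->
    dvd (h t - (g (row_mx t%:M v) - (v *m a') 0 0)).
  move=> Kv; rewrite /h; case: (rep t) => v1 /= /(_ (ex_intro _ v Kv)) Kv1.
  have lin := lin_g (-1) _ _ Kv Kv1.
  have : K (row_mx 0%:M (v1 - v)).
    by have := is_submoduleB subK Kv1 Kv; rewrite row_mx_scalarB subrr.
  move=> /Ha'; rewrite mulmxBl.
  move: lin; rewrite row_mx_scalarP scaleN1r mulN1r addNr [- v + v1]addrC.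
  rewrite !mxE; set g1 := g _; set g2 := g _; set g3 := g _.
  set s1 := \sum_j _; set s2 := \sum_j _ => lin1 lin2.
  rewrite (_ : _ - _ = (g1 - (s1 - s2)) - (g1 - (-1 * g2 + g3))); last by ring.
  exact: is_idealB.
have [|||b Hb] := selfinj (J := J) (g := h) idJ.
- exists 0; have := zK (row_mx 1%:M 0).
  by rewrite row_mx_scalarZ scaler0 mulr1.
- move=> a t t' [v Kv] [v' Kv'].
  have KD : K (row_mx (a * t + t')%:M (a *: v + v')).
    by rewrite -row_mx_scalarP; case: subK => _; apply.
  have := hE _ _ KD; have := hE _ _ Kv; have := hE _ _ Kv'.
  have := lin_g a _ _ Kv Kv'; rewrite row_mx_scalarP mulmxDl -scalemxAl.
  rewrite !(mxE, mxE); set g1 := g _; set g2 := g _; set g3 := g _.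
  set h1 := h t; set h2 := h t'; set h3 := h _.
  set s1 := \sum_j _; set s2 := \sum_j _ => d1 d2 d3 d4.
  have -> : h3 - (a * h1 + h2) = h3 - (g1 - (a * s2 + s1)) - (h2 - (g3 - s1))
     + (- a * (h1 - (g2 - s2)) + (g1 - (a * g2 + g3))) by ring.
  apply: is_idealD dvd_ideal _ _; first exact: is_idealB.
  by apply: is_idealD dvd_ideal _ _ => //; apply: is_idealMl.
- have Kz : K (row_mx z%:M 0).
    have := zK (row_mx 1%:M 0).
    by rewrite row_mx_scalarZ scaler0 mulr1.
  rewrite -[h z](subrK (g (row_mx z%:M 0) - ((0 : 'rV_k) *m a') 0 0)).
  apply: is_idealD dvd_ideal (hE _ _ Kz) _; rewrite mul0mx mxE subr0.
  have := zg (row_mx 1%:M 0).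
  by rewrite row_mx_scalarZ scaler0 mulr1.
exists (col_mx b%:M a') => v; elim/(@row_mx_scalar_ind k): v => t v Kv.
rewrite row_col_scalarE.
have := hE _ _ Kv; have /Hb : J t by exists v.
set g1 := g _; set s1 := (_ *m _) _ _ => d1 d2.
have -> : g1 - (t * b + s1) = (h t - t * b) - (h t - (g1 - s1)) by ring.
exact: is_idealB.
Qed.

(** The residue field embeds into S/z, so each nonzero class of a
    module over S/z is detected by a functional: map a socle element of the
    cyclic module that it generates to a generator of the socle and extend. *)
Lemma rV_separation (n : set S) k (K : set 'rV[S]_k) (w : 'rV_k) :
  regular_parameter n z -> is_submodule K -> (forall v, K (z *: v)) -> ~ K w ->
  exists2 a : 'cV_k, forall v, K v -> dvd ((v *m a) 0 0)
    & ~ dvd ((w *m a) 0 0).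
Proof.
move=> par subK zK Kw.
pose J : set S := [set r | K (r *: w)].
have idJ : is_ideal J.
  split; rewrite /J /=; first by rewrite scale0r; case: subK.
  by move=> a r r' Kr Kr'; rewrite scalerDl -scalerA; case: subK => _; apply.
have [||u [Ju nu]] := exists_socle par idJ; first exact: zK.
  by rewrite /J /= scale1r.
have [s [zs ns]] := exists_socle_principal par.
have colon_n r : J (r * u) -> n r.
  move=> Jru; apply: contrapT => /(rp_unit par) [b rb1]; apply: Ju.
  by rewrite -[u]mul1r -rb1 [r * b]mulrC -mulrA; apply: is_idealMl.
pose Ku : set 'rV_k := [set v | exists r, K (v - (r * u) *: w)].
have rep v : {r | Ku v -> K (v - (r * u) *: w)}.
  by apply: cid; case: (pselect (Ku v)) => [[r Kr]|Kv]; [exists r | exists 0].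
pose g v := sval (rep v) * s.
have gE v r : K (v - (r * u) *: w) -> dvd (g v - r * s).
  move=> Kr; rewrite /g; case: (rep v) => r' /= /(_ (ex_intro _ r Kr)) Kr'.
  rewrite -mulrBl; apply: ns; apply: colon_n; rewrite /J /= mulrBl scalerBl.
  by have := is_submoduleB subK Kr Kr'; rewrite opprB addrC addrA subrK.
have KuP a v v' r r' : K (v - (r * u) *: w) -> K (v' - (r' * u) *: w) ->
    K (a *: v + v' - ((a * r + r') * u) *: w).
  move=> Kr Kr'; have := (proj2 subK) a _ _ Kr Kr'.
  by rewrite scalerBr scalerA addrACA -opprD -scalerDl mulrA -mulrDl.
have KKu v : K v -> K (v - (0 * u) *: w) by rewrite mul0r scale0r subr0.
have [||||a Ha] := selfinjective_rV (K := Ku) (g := g).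
- split; first by exists 0; apply: KKu; case: subK.
  by move=> a v v' [r Kr] [r' Kr']; exists (a * r + r'); apply: KuP.
- by move=> v; exists 0; apply/KKu/zK.
- move=> a v v' [r Kr] [r' Kr'].
  have := gE _ _ (KuP a _ _ _ _ Kr Kr'); have := gE _ _ Kr; have := gE _ _ Kr'.
  move: (g v) (g v') (g (a *: v + v')) => g1 g2 g3 d2 d1 d3.
  have -> : g3 - (a * g1 + g2) =
    (g3 - (a * r + r') * s) - (a * (g1 - r * s) + (g2 - r' * s)) by ring.
  apply: is_idealB dvd_ideal d3 _; apply: is_idealD dvd_ideal _ d2.
  exact: is_idealMl.
- by move=> v; have := gE _ _ (KKu _ (zK v)); rewrite mul0r subr0.
exists a => [v Kv|dwa].
  have := gE _ _ (KKu _ Kv); rewrite mul0r subr0 => gv.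
  have /Ha : Ku v by exists 0; apply: KKu.
  by move/(is_idealB dvd_ideal gv); rewrite opprB addrC subrK.
have Kuw : K (u *: w - (1 * u) *: w) by rewrite mul1r subrr; case: subK.
have /Ha : Ku (u *: w) by exists 1.
have := gE _ _ Kuw; rewrite -scalemxAl mxE mul1r => d1 d2; apply: zs.
have -> : s = (g (u *: w) - u * (w *m a) 0 0) - (g (u *: w) - s)
   + u * (w *m a) 0 0 by ring.
apply: is_idealD dvd_ideal _ _; first exact: is_idealB.
exact: is_idealMl.
Qed.

End Extension.

Section Lifting.
Variables (n : set S) (y : S).
Hypothesis par : regular_parameter n y.
Hypothesis selfinj : forall N, selfinjective_mod (y ^+ N.+1).

(** Functionals on M = S^k/K, a module without y-torsion; let [K] be generated
    by the rows of [G]. A functional modulo a high power y^{N+1} is given by a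
    vector [a] with all entries of G a divisible by y^{N+1}. By an Artin-Rees
    argument, G a is then y times an element of the image of [G], so that
    correcting [a] by a multiple of [y] gives a vector that annihilates [K].
    It is y^N w that is separated from zero modulo y^{N+1}, and this gives
    [w] modulo [y]. *)
Lemma rV_functional k (K : set 'rV[S]_k) (w : 'rV_k) :
  is_submodule K -> (forall v, K (y *: v) -> K v) ->
  (forall v, ~ K (w - y *: v)) ->
  exists2 a : 'cV_k, forall v, K v -> (v *m a) 0 0 = 0
    & ~ principal y ((w *m a) 0 0).
Proof.
move=> subK Ksat Kw; have nS := rp_noetherian par.
have [l [G HG]] := noetherian_rV nS subK.
pose U N : set 'rV_l := [set u | exists a : 'cV_k, y ^+ N *: u = (G *m a)^T].
have subU N : is_submodule (U N).
  split; first by exists 0; rewrite mulmx0 trmx0 scaler0.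
  move=> a u v [b ub] [c vc]; exists (a *: b + c).
  by rewrite scalerDr scalerA mulrC -scalerA ub vc mulmxDr -scalemxAr linearP.
have monoU N N' u : (N <= N')%N -> U N u -> U N' u.
  move=> /subnK <- [a ua]; exists (y ^+ (N' - N) *: a).
  by rewrite exprD -scalerA ua -scalemxAr linearZ.
have [N HN] : exists N, forall N' u, U N' u -> U N u.
  have [|p [H HH]] := noetherian_rV (K := [set u | exists N, U N u]) nS.
    split; first by exists 0%N; case: (subU 0%N).
    move=> a u v [N Nu] [N' Nv]; exists (maxn N N').
    case: (subU (maxn N N')) => _; apply.
      by apply: monoU Nu; apply: leq_maxl.
    by apply: monoU Nv; apply: leq_maxr.
  have rowU i : exists N, U N (row i H).
    by apply/(HH _); exists (delta_mx 0 i); rewrite rowE.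
  have [f Hf] := choice rowU; exists (\max_i f i) => N' u Nu.
  have /(HH _) [c ->] : exists N, U N u by exists N'.
  apply: is_submodule_mulmx => // i.
  by apply: monoU (Hf i); apply: leq_bigmax.
have sat_expr N' v : K (y ^+ N' *: v) -> K v.
  elim: N' => [|N' IH]; first by rewrite expr0 scale1r.
  by rewrite exprS -scalerA => /Ksat/IH.
pose z := y ^+ N.+1.
have [|||a Ka wa] := rV_separation (@selfinj N)
  (K := [set v | exists v', K (v - z *: v')]) (w := y ^+ N *: w) (rp_expr par N).
- split; first by exists 0; rewrite scaler0 subr0; case: subK.
  move=> b u v [u' Ku] [v' Kv]; exists (b *: u' + v').
  have := (proj2 subK) b _ _ Ku Kv.
  by rewrite scalerBr addrACA -opprD scalerDr !scalerA [z * b]mulrC.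
- by move=> v; exists v; rewrite subrr; case: subK.
- case=> v; rewrite /z exprSr -scalerA -scalerBr => /sat_expr.
  exact: Kw.
have KG i : K (row i G) by apply/HG; exists (delta_mx 0 i); rewrite rowE.
have div_Ga i : exists b, (G *m a) i 0 = z * b.
  have /Ka [b bE] : exists v, K (row i G - z *: v).
    by exists 0; rewrite scaler0 subr0.
  by exists b; rewrite -bE -row_mul [RHS]mxE.
have [b Hb] := choice div_Ga.
have [|a1 Ha1] := HN N.+1 (\row_i b i).
  by exists a; apply/matrixP => i j; rewrite !ord1 !mxE -Hb mxE.
have Ga : G *m (a - y *: a1) = 0.
  rewrite mulmxBr -scalemxAr -[G *m a1]trmxK -Ha1.
  apply/matrixP => i j; rewrite ord1 !mxE.
  have := Hb i; rewrite mxE => ->.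
  by rewrite /z exprS; ring.
exists (a - y *: a1) => [v /HG [u ->]|[c cE]].
  by rewrite -mulmxA Ga mulmx0 mxE.
apply: wa; exists (c + (w *m a1) 0 0); rewrite -scalemxAl mxE.
move: cE; rewrite mulmxBr -scalemxAr !mxE => cE.
rewrite /z exprSr -mulrA mulrDr -cE; ring.
Qed.

End Lifting.
End Vectors.

(** * Krull dimension, depth and type *)

Lemma enat_least_Some (P : set nat) n :
  enat_least P = Some n -> P n /\ forall k, P k -> (n <= k)%N.
Proof.
rewrite /enat_least; case: pselect => // exP [<-].
case: ex_minnP => l /asboolP Pl minl; split=> // k Pk.
by apply: minl; apply/asboolP.
Qed.

Lemma enat_least_le (P : set nat) n :
  P n -> exists l, [/\ enat_least P = Some l, P l & (l <= n)%N].
Proof.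
move=> Pn; rewrite /enat_least; case: pselect => [exP|[]]; last first.
  by exists n; apply/asboolP.
case: ex_minnP => l /asboolP Pl minl; exists l; split=> //.
by apply: minl; apply/asboolP.
Qed.

Section QuotientLemmas.
Variables (R : pzRingType) (M : lmodType R) (N : submodClosed M).

Lemma quotmod_pi_eq0 (x : M) : (\pi_(quotmod N) x = 0) <-> x \in N.
Proof.
have pi0 : \pi_(quotmod N) 0 = 0 :> quotmod N.
  by apply: (addIr (\pi_(quotmod N) 0)); rewrite pi_quotD !add0r.
rewrite -pi0 -[in X in _ <-> X](subr0 x) -[_ \in N]/(_ \in zmod_of_submod N).
by rewrite Quotient.idealrBE; split=> [->|/eqP].
Qed.

Lemma quotmod_piZ a (x : M) : \pi_(quotmod N) (a *: x) = a *: \pi_(quotmod N) x.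
Proof. by rewrite -[RHS]/(quot_scale a _) pi_quot_scale. Qed.

Lemma quotmod_piD (x y : M) :
  \pi_(quotmod N) (x + y) = \pi_(quotmod N) x + \pi_(quotmod N) y.
Proof. by rewrite pi_quotD. Qed.

Lemma quotmod_piB (x y : M) :
  \pi_(quotmod N) (x - y) = \pi_(quotmod N) x - \pi_(quotmod N) y.
Proof. by rewrite quotmod_piD -scaleN1r quotmod_piZ scaleN1r. Qed.

End QuotientLemmas.

Section LocalRing.
Variables (R : comNzRingType) (m : idealr R).

Lemma depth1_regular (M : lmodType R) : depth m M = Some 1%N ->
  exists2 x, x \in m & forall w : M, x *: w = 0 -> w = 0.
Proof.
move=> /enat_least_Some [_ min1].
have [n [xs [szxs xm [reg _]]] n_gt0] : exists2 n, exists xs : seq R,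
    [/\ size xs = n, {subset xs <= m} & regular_sequence M xs] & (0 < n)%N.
  apply: contrapT => H; suff: (1 <= 0)%N by [].
  by apply: min1 => n Hn; rewrite leqNgt; apply/negP => n_gt0; apply: H; exists n.
case: xs szxs xm reg n_gt0 => [<- //|x xs <- xm reg _].
exists x; first by apply: xm; rewrite mem_head.
move=> w xw0.
have := reg 0%N isT (\pi_(seq_quot M [::]) w); rewrite /= -quotmod_piZ xw0 => H.
have /quotmod_pi_eq0/asboolP[u ->] : \pi_(seq_quot M [::]) w = 0.
  by apply: H; apply/quotmod_pi_eq0; apply: rpred0.
by rewrite big_ord0.
Qed.

Hypotheses (noethR : noetherian R) (localR : local_ring m).

Lemma local_unit a : a \notin m -> exists b, a * b = 1.
Proof.
move=> am; apply: contrapT => nonunit.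
have a1 : ~ principal a 1 by case=> b b1; apply: nonunit; exists b.
have [|| P [idP aP P1] maxP] := noetherian_max noethR (F := [set J |
  [/\ is_ideal J, forall b, principal a b -> J b & ~ J 1]]).
- by move=> J [].
- by exists (principal a); split=> //; apply: principal_ideal.
have maxI : maximal_ideal (idealr_of idP P1).
  move=> I PI b Ib; rewrite idealr_ofE; apply/asboolP.
  apply: (maxP [set b | b \in I]) => //; last first.
    by move=> c Pc; apply: PI; rewrite idealr_ofE; apply/asboolP.
  split; first exact: idealr_is_ideal.
    by move=> c ac; apply: PI; rewrite idealr_ofE; apply/asboolP/aP.
  by rewrite /= idealr1.
case: localR => _ /(_ _ maxI) eqm; move: am; rewrite -eqm idealr_ofE => /asboolP[].
by apply: aP; apply: principal_gen.
Qed.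

(** In a ring of dimension one every nonzerodivisor [y] of [m] is a parameter:
    if no power of a lies in yR, then some prime contains [y] and not a, and it
    contains a smaller prime that avoids the nonzerodivisor [y]. *)
Lemma dim1_regular_parameter y : krull_dim R = Some 1%N -> y \in m ->
  (forall b, y * b = 0 -> b = 0) -> regular_parameter [set a | a \in m] y.
Proof.
move=> dimR ym yreg; split=> //=.
- exact: idealr_is_ideal.
- by rewrite idealr1.
- by move=> a /negP; apply: local_unit.
move=> a am; apply: contrapT => aN.
have [||||p1 [yp1 ap1]] := exists_prime_disjoint noethR (J := principal y)
    (W := [set w | exists i, w = a ^+ i]).
- exact: principal_ideal.
- by exists 0%N.
- by move=> u v [i ->] [j ->]; exists (i + j)%N; rewrite exprD.
- by move=> _ [i ->] yai; apply: aN; exists i.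
have y_p1 : y \in p1 by apply: yp1; apply: principal_gen.
have yireg i b : y ^+ i * b = 0 -> b = 0.
  elim: i => [|i IH]; first by rewrite expr0 mul1r.
  by rewrite exprS -mulrA => /yreg/IH.
have [||||p0 [_ p0W]] := exists_prime_disjoint noethR (J := [set 0])
    (W := [set w | exists i t, t \notin p1 /\ w = y ^+ i * t]).
- by split=> // b u v /= -> ->; ring.
- by exists 0%N, 1; split; [rewrite idealr1 | ring].
- move=> _ _ [i [t [tp ->]]] [j [t' [tp' ->]]]; exists (i + j)%N, (t * t').
  by split; [rewrite prime_idealrM negb_or tp tp' | rewrite exprD; ring].
- by move=> _ [i [t [tp ->]]] /= /yireg t0; move: tp; rewrite t0 idealr0.
have [||||p2 [mp2 _]] := exists_prime_disjoint noethR (J := [set b | b \in m])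
    (W := [set 1]).
- exact: idealr_is_ideal.
- by [].
- by move=> u v /= -> ->; ring.
- by move=> _ /= ->; rewrite idealr1.
case: (enat_least_Some dimR) => /(_ 2%N) dim_le1 _.
suff: (2 <= 1)%N by [].
apply: dim_le1; exists (fun i => match i with 0 => p0 | 1 => p1 | _ => p2 end)%N.
case=> [|[|//]] _; split=> /=.
- move=> b bp0; apply: contraLR bp0 => bp1; apply: p0W; exists 0%N, b.
  by split=> //; ring.
- exists y => //; apply: p0W; exists 1%N, 1; rewrite idealr1; split=> //; ring.
- move=> b bp1; apply: mp2; apply: contrapT => /negP/local_unit [c bc1].
  by have := idealMr c bp1; rewrite mulrC bc1 idealr1.
- by exists a; [apply: mp2 | apply: ap1; exists 1%N; rewrite expr1].
Qed.

(** An element killed by [y] would have a nonzero multiple that is killed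
    by [m], which depth one excludes. *)
Lemma depth1_parameter_regular (M : lmodType R) y :
  regular_parameter [set a | a \in m] y -> depth m M = Some 1%N ->
  forall w : M, y *: w = 0 -> w = 0.
Proof.
move=> par /depth1_regular [x xm xreg] w yw0; apply: contrapT => w0.
have [|||u [/= uw0 mu]] := exists_socle par (J := [set r | r *: w = 0]).
- split=> /= [|r u v uw vw]; first by rewrite scale0r.
  by rewrite scalerDl -scalerA uw vw scaler0 addr0.
- exact: yw0.
- by rewrite /= scale1r.
by apply: uw0; apply: xreg; rewrite scalerA; apply: mu.
Qed.

Lemma residue_linear (E : lmodType R) (e : E) :
  (forall a, a \in m -> a *: e = 0) ->
  exists G : {linear residue m -> E}, forall r, G (\pi r) = (r : R) *: e.
Proof.
move=> me; pose G (q : residue m) := (repr q : R) *: e.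
have GE (r : R^o) : G (\pi r) = (r : R) *: e.
  apply/eqP; rewrite -subr_eq0 -scalerBl; apply/eqP/me.
  have : \pi_(residue m) ((repr (\pi_(residue m) r) : R^o) - r) = 0.
    by rewrite quotmod_piB reprK subrr.
  by move/quotmod_pi_eq0.
have lin_G : linear G.
  move=> a q q'; rewrite -[q]reprK -[q']reprK -quotmod_piZ -quotmod_piD !GE.
  by rewrite scalerDl scalerA.
pose G' := HB.pack_for {linear residue m -> E} G
  (GRing.isLinear.Build _ _ _ _ _ lin_G).
by exists G' => r; apply: GE.
Qed.

Section Type1.
Variables (y : R) (M : lmodType R) (I : injective_resolution M).
Hypothesis par : regular_parameter [set a | a \in m] y.
Hypothesis My : forall w : M, y *: w = 0 -> w = 0.

(** Ext^1(R/m, M) is isomorphic to Hom(R/m, M/yM): a socle element w of M/yM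
    corresponds to the cocycle that maps 1 to d(w/y). *)
Lemma type1_socle : residue_dim m (ext (residue m) I 1%N) 1%N ->
  exists w0 : M, [/\ socle_mod [set a | a \in m] y w0,
    forall v, w0 <> y *: v
    & forall w, socle_mod [set a | a \in m] y w ->
        exists r v, w = r *: w0 + y *: v].
Proof.
move=> [f bij_f]; pose one_q : residue m := \pi_(residue m) (1 : R^o).
have resE (q : residue m) : q = (repr q : R) *: one_q.
  rewrite -[LHS]reprK /one_q -quotmod_piZ; congr (\pi_(residue m) _).
  by rewrite -[RHS]/(_ * 1) mulr1.
have m_one a : a \in m -> a *: one_q = 0.
  move=> am; rewrite /one_q -quotmod_piZ; apply/quotmod_pi_eq0.
  by rewrite -[_ \in _]/(a * 1 \in m) mulr1.
pose ext1 := ext (residue m) I 1%N.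
pose one : 'I_1 -> residue m := fun=> one_q.
have ext_cyclic (xi : ext1) : exists r, xi = r *: (f one : ext1).
  case: bij_f => g fK gK; exists (repr (g xi 0) : R^o).
  rewrite -linearZ /= -[LHS]gK; congr (f _); apply/funext => i.
  by rewrite ord1; apply: resE.
have one_neq0 : (f one : ext1) <> 0.
  rewrite -(linear0 f) => /(bij_inj bij_f)/(congr1 (@^~ 0)).
  by move/quotmod_pi_eq0; rewrite -[_ \in _]/(1 \in m) idealr1.
pose F0 : cocycles (residue m) I 1%N := repr (f one : ext1).
have [lin_F0 dF0] : linear (val F0) /\ forall x, ir_d I 1 (val F0 x) = 0.
  exact/asboolP/(valP F0).
pose F0' := HB.pack_for {linear residue m -> ir_obj I 1} (val F0)
  (GRing.isLinear.Build _ _ _ _ _ lin_F0).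
pose e0 := val F0 one_q.
have F0E q : val F0 q = (repr q : R) *: e0.
  by rewrite -[LHS]/(F0' q) -[e0]/(F0' one_q) -linearZ /= -resE.
have me0 a : a \in m -> a *: e0 = 0.
  by move=> am; rewrite -[RHS](linear0 F0') -(m_one a am) linearZ.
have [v0 v0E] : exists v0, ir_d I 0 v0 = e0 by apply/ir_exactS; apply: dF0.
have aug_v0 a : a \in m -> exists w', ir_aug I w' = a *: v0.
  by move=> am; apply/ir_exact0; rewrite linearZ /= v0E me0.
have [w0 w0E] := aug_v0 y (rp_mem par).
exists w0; split.
- move=> a /aug_v0 [w' w'E]; exists w'; apply: (@ir_aug_inj _ _ I).
  by rewrite !linearZ /= w0E w'E !scalerA mulrC.
- move=> v w0v; apply: one_neq0; pose v' := v0 - ir_aug I v.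
  have dv' : ir_d I 0 v' = e0.
    by rewrite linearB /= v0E (_ : ir_d I 0 (ir_aug I v) = 0) ?subr0 //;
      apply/ir_exact0; exists v.
  have mv' a : a \in m -> a *: v' = 0.
    move=> /aug_v0 [w' w'E]; rewrite scalerBr -w'E -linearZ -linearB /=.
    suff -> : w' - a *: v = 0 by rewrite linear0.
    apply: My; apply: (@ir_aug_inj _ _ I); rewrite linear0 !(linearZ, linearB) /=.
    rewrite w'E -scalerDr scalerA mulrC -scalerA scalerBr -w0E w0v.
    by rewrite linearZ /= subrr scaler0.
  have [G GE] := residue_linear mv'.
  rewrite -[LHS]reprK; apply/quotmod_pi_eq0/asboolP; exists G.
  apply/funext => q; rewrite F0E /= -[in RHS](reprK q) GE.
  by rewrite linearZ /= dv'.
- move=> w /(socle_quotient par My I) [v vE mv].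
  have me a : a \in m -> a *: ir_d I 0 v = 0.
    by move=> /mv [w' w'E]; rewrite -linearZ /= w'E; apply/ir_exact0; exists w'.
  have [G GE] := residue_linear me.
  have cG : (G : residue m -> ir_obj I 1) \in @cocycle_pred _ (residue m) M I 1%N.
    apply/asboolP; split=> [|q]; first exact: linearP.
    rewrite -[q]reprK GE linearZ /= (_ : ir_d I 1 _ = 0) ?scaler0 //.
    by apply/ir_exactS; exists v.
  pose F : cocycles (residue m) I 1%N := SubmodType cG.
  have [r Fr] := ext_cyclic (\pi_ext1 F).
  have : \pi_ext1 (F - r *: F0) = 0.
    by rewrite quotmod_piB quotmod_piZ reprK Fr subrr.
  move/quotmod_pi_eq0/asboolP => [g gE].
  have {}gE : ir_d I 0 (g one_q) = ir_d I 0 v - r *: e0.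
    rewrite -[LHS](congr1 (@^~ one_q) gE) -[LHS]/(G one_q - r *: e0).
    by rewrite GE scale1r.
  have mg a : a \in m -> a *: g one_q = 0.
    by move=> am; rewrite -linearZ /= m_one // linear0.
  have [w' w'E] : exists w', ir_aug I w' = v - r *: v0 - g one_q.
    by apply/ir_exact0; rewrite !linearB linearZ /= v0E gE subrr.
  exists r, w'; apply: (@ir_aug_inj _ _ I).
  rewrite linearD !linearZ /= w'E w0E !scalerBr mg; last exact: (rp_mem par).
  by rewrite subr0 vE !scalerA [r * y]mulrC addrC subrK.
Qed.

End Type1.
End LocalRing.

(** * Birational Gorenstein subrings *)

Section Birational.
Variables (R : comNzRingType) (m : idealr R) (S : subringClosed R).
Local Notation T := (subringtype S).

(** The product of common denominators of the S-module generators of R maps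
    R into S. The denominators are nonzerodivisors of R because they are
    invertible in the total quotient ring of R. *)
Lemma birational_regular : finitely_generated (over_subring S) ->
  (exists (Q : comNzRingType) (phi : {rmorphism R -> Q}),
     is_localization (@nonzerodivisors R) phi /\
     is_localization (@nonzerodivisors T) (phi \o @subring_incl R S)) ->
  exists y, (forall b, y * b = 0 -> b = 0) /\ forall r, y * r \in S.
Proof.
move=> [n [e He]] [Q [phi [[_ _ kerR] [invS surjS _]]]].
have phi0 b : phi b = 0 -> b = 0.
  by move=> /kerR [w wreg wb0]; apply: wreg.
have denom (r : R) : exists p : T * T,
    (forall b, val p.2 * b = 0 -> b = 0) /\ r * val p.2 = val p.1.
  have [a [w [wreg E]]] := surjS (phi r); exists (a, w); split=> /=.
    move=> b wb0; have [u wu1] := invS w wreg; apply: phi0.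
    rewrite -[LHS]mulr1 -(wu1 : phi (val w) * u = 1) mulrA -rmorphM mulrC.
    by rewrite [b * _]mulrC wb0 rmorph0 mulr0.
  apply/eqP; rewrite -subr_eq0; apply/eqP/phi0.
  by rewrite rmorphB rmorphM; apply/eqP; rewrite subr_eq0; apply/eqP.
have [p Hp] := choice (fun i => denom (e i)).
exists (\prod_i val (p i).2); split.
  elim/big_ind: _ => [b|u v IHu IHv b|i _]; first by rewrite mul1r.
    by rewrite -mulrA => /IHu/IHv.
  by case: (Hp i).
move=> r; have [c ->] := He r; rewrite mulr_sumr; apply: rpred_sum => i _.
rewrite (bigD1 i) //=.
have -> : val (p i).2 * (\prod_(j < n | j != i) val (p j).2) * (c i *: e i)
    = \prod_(j < n | j != i) val (p j).2 * val (c i) * val (p i).1.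
  by case: (Hp i) => _ <-; rewrite -[c i *: e i]/(val (c i) * e i); ring.
by rewrite rpredM ?rpredM ?rpred_prod // => *; apply: valP.
Qed.

Variable y : R.
Hypothesis par : regular_parameter [set a | a \in m] y.
Hypothesis yR : forall r, y * r \in S.

Let yreg := rp_regular par.

Fact parameter_in_subring : y \in S.
Proof. by rewrite -[y]mulr1. Qed.

Definition sub_y : T := SubringType parameter_in_subring.

Definition sub_max : set T := [set a | val a \in m].

(** The ideals of S generated by y b^n, where b is the inverse in R of [a],
    form an ascending chain. *)
Lemma subring_unit : noetherian T ->
  forall a, ~ sub_max a -> exists b, a * b = 1.
Proof.
move=> nT a ma; have [b ab1] := rp_unit par ma.
pose t n : T := SubringType (yR (b ^+ n)).
have [n Hn] : exists n, forall k c, principal (t k) c -> principal (t n) c.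
  apply: (noetherian_chain nT (J := fun n => principal (t n))) => n.
    exact: principal_ideal.
  move=> _ [c ->]; exists (a * c); apply: val_inj.
  rewrite -[LHS]/(y * b ^+ n * val c) -[RHS]/(y * b ^+ n.+1 * (val a * val c)).
  by rewrite -[LHS]mul1r -ab1 exprS; ring.
have [c] := Hn _ _ (principal_gen (t n.+1)).
move/(congr1 val); rewrite -[LHS]/(y * b ^+ n.+1) -[RHS]/(y * b ^+ n * val c).
rewrite exprSr -mulrA => /(rp_mulI par) bE.
exists c; apply: val_inj; rewrite rmorphM rmorph1 -ab1; congr (_ * _).
have abn : val a ^+ n * b ^+ n = 1 by rewrite -exprMn ab1 expr1n.
by rewrite -[LHS]mul1r -[RHS]mul1r -abn -!mulrA bE.
Qed.

Lemma sub_max_ideal : is_ideal sub_max.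
Proof.
split; first exact: idealr0.
by move=> a u v mu mv; apply: rpredD mv; apply: idealMr.
Qed.

(** A power of an element of [m] is y^2 r, and y r lies in S. *)
Lemma subring_parameter : noetherian T -> regular_parameter sub_max sub_y.
Proof.
move=> nT; split=> //.
- exact: sub_max_ideal.
- by rewrite /sub_max /= idealr1.
- exact: subring_unit.
- exact: (rp_mem par).
- by move=> b /(congr1 val) yb0; apply: val_inj; apply: yreg.
move=> a /(rp_power (rp_expr par 1)) [N [r aE]].
exists N, (SubringType (yR r)); apply: val_inj.
by rewrite rmorphXn [LHS]aE rmorphM /=; ring.
Qed.

(** S is local, hence its own localization at the maximal ideal. *)
Lemma gorenstein_subring_injdim : gorenstein T -> finite_injdim (T^o : lmodType T).
Proof.
move=> [nT gorT]; have parT := subring_parameter nT.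
pose n := idealr_of sub_max_ideal (rp_proper parT).
have nE a : (a \in n) = `[< sub_max a >] by [].
have max_n : maximal_ideal n.
  move=> J _ a Ja; rewrite nE; apply/asboolP.
  apply: (rp_proper_sub parT (idealr_is_ideal J) _ Ja).
  by rewrite /= idealr1.
have loc : is_localization [set w | w \notin n] (idfun : {rmorphism T -> T}).
  split.
  - by move=> w /=; rewrite nE => /asboolPn; apply: (rp_unit parT).
  - by move=> b; exists b, 1; split; [rewrite /= (idealr1 n) | rewrite mulr1].
  - by move=> a /= ->; exists 1; [rewrite /= (idealr1 n) | rewrite mulr0].
by case: (gorT n max_n T idfun loc).
Qed.

Hypothesis Rfin : finitely_generated (over_subring S).
Hypothesis gorT : gorenstein T.

Let parT : regular_parameter sub_max sub_y := subring_parameter (proj1 gorT).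

Fact subring_selfinjective N : selfinjective_mod (sub_y ^+ N.+1).
Proof.
apply: finite_injdim_selfinjective (rp_expr parT N) _.
exact: gorenstein_subring_injdim.
Qed.

Lemma restrict_generators (M : lmodType R) : finitely_generated M ->
  exists k (g : 'I_k -> M),
    forall w, exists v : 'rV[T]_k, w = \sum_i val (v 0 i) *: g i.
Proof.
case: Rfin => p [d Hd] [n [e He]].
pose I : finType := ('I_n * 'I_p)%type.
exists #|I|, (fun i => (d (enum_val i).2 : R) *: e (enum_val i).1) => w.
have [c ->] := He w; have [f Hf] := choice (fun i => Hd (c i)).
exists (\row_i f (enum_val i).1 (enum_val i).2).
pose F i j := val (f i j) *: ((d j : R) *: e i).
rewrite (eq_bigr (fun i => F (enum_val i).1 (enum_val i).2)); last first.
  by move=> i _; rewrite mxE.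
rewrite -(reindex (fun i => enum_val i) (P := xpredT) (F := fun q : I => F q.1 q.2));
  last exact/onW_bij/enum_val_bij.
rewrite -(pair_bigA _ F) /=; apply: eq_bigr => i _.
rewrite [c i]Hf scaler_suml; apply: eq_bigr => j _.
by rewrite /F scalerA.
Qed.

(** An S-linear functional from an R-module to S is R-linear, because [y] is
    a nonzerodivisor that maps R into S; hence its values lie in the conductor.
    The functional is on M/N, so that no quotient module has to be formed. *)
Lemma conductor_functional (M : lmodType R) (N : set M) w :
  finitely_generated M ->
  (N 0 /\ forall a u v, N u -> N v -> N (a *: u + v)) ->
  (forall v, N (y *: v) -> N v) -> (forall v, ~ N (w - y *: v)) ->
  exists h : M -> R,
    [/\ forall r u v, h (r *: u + v) = r * h u + h v,
        forall u r, h u * r \in S, forall u, N u -> h u = 0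
      & forall s, s \in S -> h w <> y * s].
Proof.
move=> /restrict_generators [k [g Hg]] [N0 ND] Nsat Nw.
pose phi (v : 'rV[T]_k) := \sum_i val (v 0 i) *: g i.
have phiP a u v : phi (a *: u + v) = val a *: phi u + phi v.
  rewrite /phi scaler_sumr -big_split; apply: eq_bigr => i _.
  by rewrite !mxE /= scalerDl scalerA.
have phi0 : phi 0 = 0.
  by rewrite /phi big1 // => i _; rewrite mxE scale0r.
have [v0 wE] := Hg w.
have phiZ a u : phi (a *: u) = val a *: phi u.
  by rewrite -[a *: u]addr0 phiP phi0 addr0.
have phiB u v : phi (u - v) = phi u - phi v.
  by rewrite [u - v]addrC -[- v]scaleN1r phiP rmorphN1 scaleN1r addrC.
have [|||a Ka wa] := rV_functional parT subring_selfinjective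
  (K := [set v | N (phi v)]) (w := v0).
- split=> /= [|b u v Nu Nv]; first by rewrite phi0.
  by rewrite phiP; apply: ND.
- by move=> v /=; rewrite phiZ; apply: Nsat.
- by move=> v /=; rewrite phiB phiZ -[phi v0]wE; apply: Nw.
have [rep Hrep] := choice Hg.
pose h u := val ((rep u *m a) 0 0).
have hE v : h (phi v) = val ((v *m a) 0 0).
  apply/eqP; rewrite -subr_eq0 -rmorphB; apply/eqP.
  have := Ka (rep (phi v) - v); rewrite mulmxBl !mxE => -> //.
  by rewrite /= phiB -[phi (rep _)]Hrep subrr.
have hS s u v : s \in S -> h (s *: u + v) = s * h u + h v.
  move=> sS; have [u' ->] := Hg u; have [v' ->] := Hg v.
  rewrite -[s]/(val (SubringType sS : T)) -[\sum_i _]/(phi u') -[\sum_i _]/(phi v').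
  by rewrite -phiP !hE mulmxDl -scalemxAl !mxE.
have h0 : h 0 = 0 by rewrite -[X in h X]phi0 hE mul0mx mxE.
have hR r u v : h (r *: u + v) = r * h u + h v.
  apply: (rp_mulI par); have yS := parameter_in_subring.
  have hSZ s x : s \in S -> h (s *: x) = s * h x.
    by move=> sS; rewrite -[s *: x]addr0 hS // h0 addr0.
  by rewrite -hSZ // scalerDr scalerA hS // hSZ // mulrDr mulrA.
exists h; split=> //.
- move=> u r; have -> : h u * r = h (r *: u).
    by rewrite -[r *: u]addr0 hR h0 addr0 mulrC.
  exact: valP.
- move=> u Nu; rewrite /h Ka ?rmorph0 //= -[phi _]Hrep.
  exact: Nu.
- move=> s sS hw; apply: wa; exists (SubringType sS).
  by apply: val_inj; rewrite -hE -[phi v0]wE hw rmorphM.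
Qed.

End Birational.

(** * The canonical module and the conductor *)

Section Conductor.
Variables (R : comNzRingType) (m : idealr R) (S : subringClosed R).
Local Notation T := (subringtype S).
Variable y : R.
Hypothesis par : regular_parameter [set a | a \in m] y.
Hypothesis yR : forall r, y * r \in S.
Hypothesis Rfin : finitely_generated (over_subring S).
Hypothesis gorT : gorenstein T.

Local Notation max := [set a | a \in m].

(** A functional that does not vanish on the socle of omega/y is onto the
    conductor: its image is faithful, whereas a proper submodule of the
    conductor with torsion-free quotient is annihilated by the value at 1 of a
    nonzero functional on R. *)
Lemma canonical_onto_conductor (omega : lmodType R) (I : injective_resolution omega) :
  finitely_generated omega -> (forall w : omega, y *: w = 0 -> w = 0) ->
  finite_injdim omega -> residue_dim m (ext (residue m) I 1%N) 1%N ->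
  exists h : omega -> R,
    [/\ forall r u v, h (r *: u + v) = r * h u + h v,
        forall u r, h u * r \in S
      & forall c, (forall r, c * r \in S) -> exists w, h w = c].
Proof.
move=> fg_omega y_omega injdim_omega type1.
have [w0 [mw0 w0y socle_w0]] := type1_socle par y_omega type1.
have [|||h [hP hS _ hw0]] := conductor_functional par yR Rfin gorT
    (N := [set 0]) (w := w0) fg_omega.
- by split=> // a u v /= -> ->; rewrite scaler0 addr0.
- exact: y_omega.
- by move=> v /= /eqP; rewrite subr_eq0 => /eqP; apply: w0y.
have h0 : h 0 = 0.
  by have := hP (-1) 0 0; rewrite scaler0 addr0 mulN1r addNr.
have hZ r u : h (r *: u) = r * h u by rewrite -[r *: u]addr0 hP h0 addr0.
have hD u v : h (u + v) = h u + h v by rewrite -[u]scale1r hP mul1r scale1r.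
have hin u : h u \in S by rewrite -[h u]mulr1.
(* [h] is injective from omega/y to c/y: otherwise the kernel would contain
   the socle, which is spanned by the class of [w0]. *)
have h_y w c : (forall r, c * r \in S) -> h w = y * c -> exists v, w = y *: v.
  move=> cS hw; apply: contrapT => wy.
  have [|||u [/= uw mu]] := exists_socle par (J := [set r | exists v, r *: w = y *: v]).
  - split=> /= [|a r r' [v rv] [v' rv']]; first by exists 0; rewrite scale0r scaler0.
    exists (a *: v + v'); rewrite scalerDl -scalerA rv rv' scalerDr !scalerA.
    by rewrite [y * a]mulrC.
  - by exists w.
  - by move=> /= [v]; rewrite scale1r => wE; apply: wy; exists v.
  have [|r [v uwE]] := socle_w0 (u *: w).
    by move=> a /mu /= [v auw]; exists v; rewrite scalerA.
  have rm : ~ max r.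
    move=> /mw0 [v' rw0]; apply: uw; exists (v' + v).
    by rewrite uwE rw0 -scalerDr.
  have [r' rr'] := rp_unit par rm.
  have w0E : w0 = r' *: (u *: w) - r' *: (y *: v).
    by rewrite -scalerBr uwE addrK scalerA [r' * r]mulrC rr' scale1r.
  apply: (hw0 (c * (r' * u) - r' * h v)); first by rewrite rpredB // mulrC.
  by rewrite w0E -scaleN1r addrC hP !hZ hw; ring.
have h_faithful a : (forall w, a * h w = 0) -> a = 0.
  move=> ah; apply: (y_divisible_sub par (I := [set 0]) (P := [set a | forall w, a * h w = 0])
    _ _ ah) => [|{ah} {}a /= ah].
    by split=> // b u v /= -> ->; ring.
  case: (pselect (principal y a)) => [[b aE]|ya].
    exists b => [w|]; last by rewrite aE subrr.
    by apply: (rp_regular par); rewrite mulrA -aE.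
  (* A multiple s of a represents a socle element of R/y, and w0 is s v
     modulo y, by injectivity of omega/y; but h (s v) = 0. *)
  have [|||u [/= ua mu]] := exists_socle par (J := [set r | principal y (r * a)]).
  - split=> /= [|b r r' Jr Jr']; first by rewrite mul0r; case: (principal_ideal y).
    by rewrite mulrDl -mulrA; case: (principal_ideal y) => _; apply.
  - by exists a.
  - by rewrite /= mul1r.
  have [|v [v' w0E]] := finite_injdim_socle par y_omega injdim_omega ua _ mw0.
    by move=> b /mu; rewrite /= mulrA.
  case: (hw0 (h v')) => //.
  by rewrite w0E hD !hZ -mulrA ah mulr0 add0r.
have h_yk k c w : (forall r, c * r \in S) -> h w = y ^+ k * c ->
    exists v, h v = c.
  move=> cS; elim: k w => [|k IH] w; first by exists w; rewrite -[c]mul1r.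
  rewrite exprS -mulrA => hw.
  have ykS r : y ^+ k * c * r \in S.
    by rewrite -mulrA rpredM ?rpredX //; apply: parameter_in_subring yR.
  have [v wE] := h_y w _ ykS hw.
  by apply: (IH v); apply: (rp_mulI par); rewrite -hw wE hZ.
exists h; split=> // c cS; apply: contrapT => hc.
(* R/N is the quotient of R/I by its y-torsion, where I is the image of [h]. *)
pose N : set R := [set r | exists k w, y ^+ k * r = h w].
have NP a r r' : N r -> N r' -> N (a * r + r').
  move=> [k [w rw]] [k' [w' rw']].
  exists (k + k')%N, ((y ^+ k' * a) *: w + y ^+ k *: w').
  by rewrite hP hZ -rw -rw' exprD; ring.
have N1 : ~ N 1.
  case=> k [w]; rewrite mulr1 => ykw; apply: hc.
  by apply: (h_yk k c (c *: w)) => //; rewrite hZ -ykw mulrC.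
have N0 : N 0 by exists 0%N, 0; rewrite h0 mulr0.
have fgR : finitely_generated (R^o : lmodType R).
  by exists 1%N, (fun=> 1) => x; exists (fun=> x); rewrite big_ord1 -[RHS]/(x * 1) mulr1.
have [||h2 [h2P h2S h2N h2_1]] := conductor_functional par yR Rfin gorT
    (M := R^o) (N := N) (w := 1) fgR (conj N0 NP).
- move=> v [k [w yv]]; exists k.+1, w.
  by rewrite -yv exprSr -[y *: v]/(y * v) mulrA.
- move=> v Nv; apply: N1.
  have [|b bE] := rp_1B par (a := y * v).
    by rewrite mulrC; apply: is_idealMl (rp_ideal par) (rp_mem par).
  by rewrite -bE mulrC -[_ * _]addr0; apply: NP.
have h20 : h2 1 = 0.
  apply: h_faithful => w; rewrite mulrC.
  have -> : h w * h2 1 = h2 (h w *: (1 : R^o)).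
    by rewrite -[h w *: _]addr0 h2P (h2N 0 N0) addr0.
  apply: h2N; exists 0%N, w.
  by rewrite expr0 mul1r -[LHS]/(h w * 1) mulr1.
by apply: (h2_1 0); rewrite ?rpred0 // mulr0.
Qed.

(** In the self-injective ring S/z every ideal is the annihilator of its
    annihilator. *)
Lemma subring_annihilator (z : T) (L : set T) (t : T) :
  regular_parameter (@sub_max R m S) z -> selfinjective_mod z ->
  is_ideal L -> L z -> ~ L t ->
  exists2 b, forall u, L u -> principal z (u * b) & ~ principal z (t * b).
Proof.
move=> parz selfinj idL Lz Lt.
have [|||a La ta] := rV_separation selfinj
  (K := [set v : 'rV[T]_1 | L (v 0 0)]) (w := const_mx t) parz.
- split=> /= [|c u v Lu Lv]; first by rewrite mxE; case: idL.
  by rewrite !mxE; case: idL => _; apply.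
- by move=> v /=; rewrite mxE mulrC; apply: is_idealMl.
- by rewrite /= mxE.
exists (a 0 0) => [u Lu|].
  by have := La (const_mx u); rewrite !mxE big_ord1 mxE; apply; rewrite /= mxE.
by move: ta; rewrite !mxE big_ord1 mxE.
Qed.

(** * Lengths *)

Definition is_overmodule (A : set R) :=
  (forall s, s \in S -> A s) /\
  forall s u v, s \in S -> A u -> A v -> A (s * u + v).

(** The duality A |-> (S : A), from ideals of S that contain the conductor to
    S-modules between S and R, is strict. The element that separates the duals
    is b/y, with b in S from the annihilator duality modulo y; another
    application of this duality, modulo y^2, shows that b/y is in R. *)
Lemma colon_strict (B : set R) s :
  is_ideal B -> (forall c, (forall r, c * r \in S) -> B c) ->
  s \in S -> ~ B s ->
  exists r, (forall t, t \in S -> B t -> r * t \in S) /\ r * s \notin S.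
Proof.
move=> idB cB sS Bs; pose yT := sub_y yR.
have parT : regular_parameter (@sub_max R m S) yT by apply: subring_parameter (proj1 gorT).
have selfinj N : selfinjective_mod (yT ^+ N.+1).
  exact: (@subring_selfinjective _ _ _ _ par yR gorT N).
pose L : set T := [set t | B (val t)].
have [|||b Lb sb] := @subring_annihilator yT L (SubringType sS) parT (selfinj 0%N).
- split; first by case: idB.
  by move=> a u v Lu Lv; case: idB => _; apply.
- exact: cB.
- exact: Bs.
have [r bE] : exists r, val b = y * r.
  apply: contrapT => yb.
  have [|||b' Lb' bb'] := @subring_annihilator (yT ^+ 2)
      [set t | exists r, val t = y * r] b (rp_expr parT 1) (selfinj 1%N).
  - split; first by exists 0; rewrite mulr0.
    move=> a u v /= [r uE] [r' vE]; exists (val a * r + r').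
    rewrite -[LHS]/(val a * subring_val u + subring_val v) uE vE; ring.
  - by exists y; rewrite rmorphXn /= expr2.
  - exact: yb.
  have [|a aE] := Lb' yT; first by exists 1; rewrite mulr1.
  have {}aE : b' = yT * a.
    by apply: (rp_mulI parT); rewrite aE expr2 mulrA.
  apply: bb'; have [|d dE] := Lb a.
    apply: cB => x; have [|d] := Lb' (SubringType (yR x)); first by exists x.
    rewrite aE => /(congr1 val).
    rewrite -[LHS]/(y * x * (y * val a)) -[RHS]/(y * y * val d).
    rewrite (_ : y * x * (y * val a) = y * (y * (val a * x))); last by ring.
    rewrite -mulrA => /(rp_mulI par)/(rp_mulI par) ->.
    exact: valP.
  by exists d; rewrite aE expr2 -mulrA -dE; ring.
exists r; split=> [t tS Bt|].
  have [|d /(congr1 val)] := Lb (SubringType tS); first exact: Bt.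
  rewrite !rmorphM /= bE mulrCA => /(rp_mulI par); rewrite mulrC => ->.
  exact: valP.
apply/negP => rs; apply: sb; exists (SubringType rs); apply: val_inj.
by rewrite !rmorphM /= bE; ring.
Qed.

End Conductor.

(** The rank of a submodule is the supremum of the lengths of the chains that
    it contains. *)
Lemma module_length_rank (R : pzRingType) (M : lmodType R) n :
  module_length M = Some n ->
  exists rho : submodClosed M -> nat,
    [/\ forall P, (rho P <= n)%N,
        forall P P' : submodClosed M, {subset P <= P'} -> (rho P <= rho P')%N
      & forall P P' : submodClosed M, sub_proper P P' -> (rho P < rho P')%N].
Proof.
move=> /enat_least_Some [len_n _].
pose chain (P : submodClosed M) k := exists N : nat -> submodClosed M,
  (forall i, (i < k)%N -> sub_proper (N i) (N i.+1)) /\ {subset N k <= P}.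
have ex_chain P : exists k, `[< chain P k >].
  by exists 0%N; apply/asboolP; exists (fun=> P); split.
have chain_le P k : `[< chain P k >] -> (k <= n)%N.
  by move=> /asboolP [N [HN _]]; apply: len_n; exists N.
exists (fun P => ex_maxn (ex_chain P) (@chain_le P)); split=> [P|P P' PP'|P P' PP'].
- by case: ex_maxnP => k /chain_le.
- case: ex_maxnP => k /asboolP [N [HN NP]] _; case: ex_maxnP => k' _; apply.
  by apply/asboolP; exists N; split=> // x /NP/PP'.
- case: ex_maxnP => k /asboolP [N [HN NP]] _; case: ex_maxnP => k' _; apply.
  apply/asboolP; exists (fun i => if (i <= k)%N then N i else P').
  rewrite ltnn; split=> // i; rewrite ltnS => ik; rewrite ik.
  case: ltnP => [|ki]; first exact: HN.
  have -> : i = k by apply/eqP; rewrite eqn_leq ik.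
  case: PP' => PP' [x xP' xP]; split=> [u /NP/PP' //|].
  by exists x => //; apply: contra xP; apply: NP.
Qed.

Section Overmodules.
Variables (R : comNzRingType) (S : subringClosed R).

Section QuotientSubmodule.
Variables (A : set R) (overA : is_overmodule S A).

Definition over_quot_pred : {pred subring_quot S} :=
  fun q => `[< A (repr q : over_subring S) >].

Lemma over_quot_pi (r : over_subring S) :
  (\pi_(subring_quot S) r \in over_quot_pred) = `[< A r >].
Proof.
case: overA => AS AP; set q := \pi_(subring_quot S) r.
have dS : (repr q : over_subring S) - r \in @subring_submod R S.
  by apply/quotmod_pi_eq0; rewrite quotmod_piB reprK subrr.
apply/asboolP/asboolP => [Aq|Ar].
  have -> : (r : R) = (-1) * ((repr q : R) - r) + (repr q : R) by ring.
  by apply: AP => //; [rewrite rpredN rpred1 | apply: AS].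
have -> : (repr q : R) = 1 * ((repr q : R) - r) + r by ring.
by apply: AP => //; [rewrite rpred1 | apply: AS].
Qed.

Fact over_quot_closed : submod_closed over_quot_pred.
Proof.
case: overA => AS AP; split.
  have -> : 0 = \pi_(subring_quot S) 0 by apply/esym/quotmod_pi_eq0/rpred0.
  by rewrite over_quot_pi; apply/asboolP/AS/rpred0.
move=> a u v; rewrite -[u]reprK -[v]reprK -quotmod_piZ -quotmod_piD.
rewrite !over_quot_pi => /asboolP Au /asboolP Av; apply/asboolP.
by apply: AP => //; apply: valP.
Qed.

HB.instance Definition _ := GRing.isSubmodClosed.Build (subringtype S)
  (subring_quot S) over_quot_pred over_quot_closed.

Definition over_quot : submodClosed (subring_quot S) := over_quot_pred.

Lemma over_quotE r : (\pi_(subring_quot S) r \in over_quot) = `[< A r >].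
Proof. exact: over_quot_pi. Qed.

End QuotientSubmodule.

Lemma overmodule_rank n : module_length (subring_quot S) = Some n ->
  exists rho : set R -> nat, [/\ forall A, (rho A <= n)%N,
    forall A A' : set R, is_overmodule S A -> is_overmodule S A' ->
      (forall r, A r -> A' r) -> (rho A <= rho A')%N
  & forall A A' : set R, is_overmodule S A -> is_overmodule S A' ->
      (forall r, A r -> A' r) -> (exists2 r, A' r & ~ A r) ->
      (rho A < rho A')%N].
Proof.
move=> /module_length_rank [rho [rho_n rho_le rho_lt]].
pose rho' A := if pselect (is_overmodule S A) is left overA
  then rho (over_quot overA) else 0%N.
have sub A A' (oA : is_overmodule S A) (oA' : is_overmodule S A') :
    (forall r, A r -> A' r) -> {subset over_quot oA <= over_quot oA'}.
  move=> AA' q; rewrite -[q]reprK !over_quotE => /asboolP Aq.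
  exact/asboolP/AA'.
exists rho'; rewrite /rho'; split=> [A|A A' oA oA' AA'|A A' oA oA' AA' [r A'r Ar]].
- by case: pselect.
- by case: pselect => // {}oA; case: pselect => // {}oA'; apply/rho_le/sub.
- case: pselect => // {}oA; case: pselect => // {}oA'; apply: rho_lt.
  split; first exact: sub.
  by exists (\pi_(subring_quot S) r); rewrite over_quotE; [apply/asboolP | apply/asboolPn].
Qed.

End Overmodules.

Section ConductorLength.
Variables (R : comNzRingType) (m : idealr R) (S : subringClosed R).
Variable y : R.
Hypothesis par : regular_parameter [set a | a \in m] y.
Hypothesis yR : forall r, y * r \in S.
Hypothesis gorT : gorenstein (subringtype S).

(** A chain of ideals B_i of R between the conductor and R gives the
    increasing chain of the B_i + S and the decreasing chain of the
    (S : B_i \cap S), both between S and R. At each index one of them is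
    strict. *)
Lemma conductor_chain_length n k (B : nat -> set R) :
  module_length (subring_quot S) = Some n ->
  (forall i, is_ideal (B i)) ->
  (forall i c, (forall r, c * r \in S) -> B i c) ->
  (forall i, (i < k)%N -> (forall r, B i r -> B i.+1 r) /\
                          exists2 r, B i.+1 r & ~ B i r) ->
  (k <= 2 * n)%N.
Proof.
move=> /overmodule_rank [rho [rho_n rho_le rho_lt]] idB cB incB.
pose up i : set R := [set r | exists b s, [/\ B i b, s \in S & r = b + s]].
pose dn i : set R := [set r | forall t, t \in S -> B i t -> r * t \in S].
have over_up i : is_overmodule S (up i).
  split=> [s sS|s _ _ sS [b [t [Bb tS ->]]] [b' [t' [Bb' t'S ->]]]].
    by exists 0, s; split=> //; [case: (idB i) | ring].
  exists (s * b + b'), (s * t + t'); split; [|by rewrite rpredD ?rpredM | ring].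
  by case: (idB i) => _; apply.
have over_dn i : is_overmodule S (dn i).
  split=> [s sS t tS _|s u v sS Hu Hv t tS Bt]; first by rewrite rpredM.
  by rewrite mulrDl -mulrA; apply: rpredD; [apply: rpredM; [|apply: Hu] | apply: Hv].
have up_le i : (i < k)%N -> forall r, up i r -> up i.+1 r.
  by move=> /incB [BB _] r [b [s [Bb sS ->]]]; exists b, s; split=> //; apply: BB.
have dn_le i : (i < k)%N -> forall r, dn i.+1 r -> dn i r.
  by move=> /incB [BB _] r dr t tS /BB; apply: dr.
have strict i : (i < k)%N ->
    (rho (up i) < rho (up i.+1))%N \/ (rho (dn i.+1) < rho (dn i))%N.
  move=> ik; have [BB [r Br nBr]] := incB i ik.
  case: (pselect (up i r)) => [[b [s [Bb sS rE]]]|nur]; [right | left].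
    have sE : s = r - b by rewrite rE addrC addKr.
    have Bs : B i.+1 s by rewrite sE; apply: is_idealB (BB _ Bb).
    have nBs : ~ B i s by move=> Bs'; apply: nBr; rewrite rE; apply: is_idealD.
    have [d [dS ds]] := colon_strict par yR gorT (idB i) (cB i) sS nBs.
    apply: rho_lt => //; first exact: dn_le.
    by exists d => // dns; move: ds; rewrite dns.
  apply: rho_lt => //; first exact: up_le.
  by exists r => //; exists r, 0; split=> //; [apply: rpred0 | ring].
have : (k + rho (dn k) <= rho (up k) + rho (dn 0))%N.
  have : (k <= k)%N by [].
  elim: {1 3 4 5}k => [|i IH] ik; first by rewrite add0n leq_addl.
  have := IH (ltnW ik); have := rho_le _ _ (over_up i) (over_up i.+1) (up_le i ik).
  have := rho_le _ _ (over_dn i.+1) (over_dn i) (dn_le i ik).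
  by case: (strict i ik); lia.
have := rho_n (up k); have := rho_n (dn 0%N); lia.
Qed.

Lemma conductor_quotient_length n (M : lmodType R) (f : {linear M -> R^o}) :
  module_length (subring_quot S) = Some n ->
  (forall c : R, (forall r, c * r \in S) -> exists w, f w = c) ->
  exists2 l, module_length (quotmod (lrange f)) = Some l & (l <= 2 * n)%N.
Proof.
move=> len_n onto.
have [|l [lenE _ l2n]] := @enat_least_le [set b | forall k : nat,
  (exists N : nat -> submodClosed (quotmod (lrange f)), forall i,
     (i < k)%N -> sub_proper (N i) (N i.+1)) -> (k <= b)%N] (2 * n)%N.
  move=> k [N HN].
  pose B i : set R := [set r | \pi_(quotmod (lrange f)) (r : R^o) \in N i].
  apply: (conductor_chain_length (B := B) len_n) => [i|i c cS|i /HN [sub [q qN' qN]]].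
  - split; first by rewrite /B /= (proj2 (quotmod_pi_eq0 _ _)) ?rpred0.
    move=> a u v Bu Bv; rewrite /B /= -[a * u]/(a *: (u : R^o)) quotmod_piD quotmod_piZ.
    by apply: rpredD => //; apply: rpredZ.
  - rewrite /B /= (proj2 (quotmod_pi_eq0 _ _)) ?rpred0 //.
    by apply/asboolP; have [w wE] := onto c cS; exists w.
  - split=> [r|]; first exact: sub.
    by exists (repr q); rewrite /B /= reprK //; apply/negP.
by exists l.
Qed.

End ConductorLength.

Theorem theorem1p5 (R : comNzRingType) (m : idealr R)
    (R_noetherian : noetherian R) (R_local : local_ring m)
    (R_CM : cohen_macaulay_local m) (R_dim1 : krull_dim R = Some 1%N)
    (omega : lmodType R) (omega_canonical : canonical_module m omega)
    (R_gen_gorenstein : generically_gorenstein R) :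
  enat_le (h_invariant omega) (enat_double (bg R)).
Proof.
case bgE: (bg R) => [n|]; last by case: (h_invariant omega).
have [[S [[Rfin birat gorS] lenS]] _] := enat_least_Some bgE.
have depthR : depth m R^o = Some 1%N by rewrite R_CM.
have [fg_omega depth_omega [t [I [depth_t type1]]] injdim_omega] := omega_canonical.
have depth_omega1 : depth m omega = Some 1%N by rewrite depth_omega.
move: type1; have -> : t = 1%N by move: depth_t; rewrite depth_omega1 => -[].
move=> type1.
have [x xm xreg] := depth1_regular depthR.
have [y0 [y0reg y0S]] := birational_regular Rfin birat.
have par : regular_parameter [set a | a \in m] (y0 * x).
  apply: dim1_regular_parameter => //; first exact: idealMr.
  by move=> b; rewrite -mulrA => /y0reg; apply: xreg.
have yS r : y0 * x * r \in S by rewrite -mulrA.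
have y_omega := depth1_parameter_regular par depth_omega1.
have [h [hP hS h_onto]] :=
  canonical_onto_conductor par yS Rfin gorS fg_omega y_omega injdim_omega type1.
have lin_h : linear (h : omega -> R^o) by [].
pose f := HB.pack_for {linear omega -> R^o} (h : omega -> R^o)
  (GRing.isLinear.Build _ _ _ _ _ lin_h).
have [l lenE l2n] := conductor_quotient_length par yS gorS (f := f)
  (esym lenS) h_onto.
have [|l' [hE _ l'l]] := @enat_least_le [set l | exists f : {linear omega -> R^o},
    Some l = module_length (quotmod (lrange f))] l; first by exists f.
rewrite (hE : h_invariant omega = Some l') /=.
exact: leq_trans l'l l2n.
Qed.
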